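(* The Hill equation $u''+e^zu=0$ is s-integrable. Indeed, the Hill foliation $\mathcal{H}:\ \omega=-y\,dx+x\,dy+[y^2+e^zx^2]\,dz=0$ on $\mathbb{C}^3$ admits the first integral $$H(x,y,z)=\frac{2yY_0(2e^{z/2})-2x\,e^{z/2}\,Y_1(2e^{z/2})}{yJ_0(2e^{z/2})-x\,e^{z/2}\,J_1(2e^{z/2})}.$$
   Context: The Hill vector field of the equation $u''+e^zu=0$ is $X=y\frac{\partial}{\partial x}-e^zx\frac{\partial}{\partial y}+\frac{\partial}{\partial z}$ on $\mathbb{C}^3$ (order reduction $x=u$, $y=u'$). A complex vector field is s-integrable (integrable in the strong sense) if it is tangent to a codimension one, possibly singular, complex analytic foliation which can be chosen to have a first integral; the equation is called s-integrable if its Hill vector field is. A first integral of the foliation $\omega=0$ is a non-constant function $H$ with $dH\wedge\omega=0$. $J_0,J_1$ and $Y_0,Y_1$ are the Bessel functions of first and second type (kind) of orders $0$ and $1$: $J_\nu(z)=\sum_{k\ge 0}\frac{(-1)^k}{\Gamma(k+1)\Gamma(\nu+k+1)}\left(\frac z2\right)^{2k+\nu}$, $Y_\nu(z)=\frac{J_\nu(z)\cos(\nu\pi)-J_{-\nu}(z)}{\sin(\nu\pi)}$ for $\nu\notin\mathbb{Z}$, and $Y_n=\lim_{\nu\to n}Y_\nu$ for $n\in\mathbb{Z}$.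
   Formalization: The printed H is not a first integral (sign misprint); both minus signs are replaced by plus: H=(2yY_0+2xe^{z/2}Y_1)/(yJ_0+xe^{z/2}J_1) at 2e^{z/2}, with the Bessel functions continued holomorphically in z over all of C. *)

(* Defs.v *)
From Stdlib Require Import Reals ZArith Lra.
From Coquelicot Require Import Coquelicot.

Open Scope R_scope.
Open Scope C_scope.

(** * Complex-valued functions of a complex variable *)

Definition Cexp (z : C) : C := (exp (Re z) * cos (Im z), exp (Re z) * sin (Im z))%R.
Definition Ccos (z : C) : C := (Cexp (Ci * z) + Cexp (- (Ci * z))) / RtoC 2.
Definition Csin (z : C) : C := (Cexp (Ci * z) - Cexp (- (Ci * z))) / (RtoC 2 * Ci).

Definition C_lim_seq (u : nat -> C) : C :=
  (real (Lim_seq (fun n => Re (u n))), real (Lim_seq (fun n => Im (u n)))).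

Definition C_Series (u : nat -> C) : C := C_lim_seq (fun n => sum_n u n).

Fixpoint rising (s : C) (n : nat) : C :=
  match n with
  | O => RtoC 1
  | S m => rising s m * (s + RtoC (INR m))
  end.

(** Gauss' formula: Gamma(s) is the limit of n! n^s / (s (s+1) ... (s+n)).
    At the poles s = 0, -1, -2, ... the quotients are eventually [_ / 0 = 0],
    so [/ CGamma s] is 0 there, as the entire function 1/Gamma is. *)
Definition CGamma (s : C) : C :=
  C_lim_seq (fun n =>
    RtoC (INR (fact n)) * Cexp (s * RtoC (ln (INR n))) / rising s (S n)).

(** * Bessel functions

    The Bessel functions are multivalued in w, through the power (w/2)^nu: they
    are single-valued on the Riemann surface of the logarithm.  A point of that
    surface is given here by the value [l] of log w, so that w = exp l,
    log (w/2) = l - log 2 and (w/2)^s = exp (s (l - log 2)). *)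

Definition half_pow (l s : C) : C := Cexp (s * (l - RtoC (ln 2))).

Definition besselJ (nu l : C) : C :=
  C_Series (fun k =>
    RtoC ((-1) ^ k)
      / (CGamma (RtoC (INR k + 1)) * CGamma (nu + RtoC (INR k + 1)))
      * half_pow l (RtoC (INR (2 * k)) + nu)).

(** Meaningful for non-integral [nu] only. *)
Definition besselY_nonint (nu l : C) : C :=
  (besselJ nu l * Ccos (nu * RtoC PI) - besselJ (- nu) l) / Csin (nu * RtoC PI).

Definition besselY (n : Z) (l : C) : C :=
  C_lim (fun nu => besselY_nonint nu l) (RtoC (IZR n)).

(** * Differential forms and foliations on C^3 *)

Notation C3 := (C * C * C)%type.

Definition entire (f : C3 -> C) : Prop :=
  forall p : C3, ex_filterdiff (K := C_AbsRing) f (locally p).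

Definition holomorphic_near (p : C3) (f : C3 -> C) : Prop :=
  locally p (fun q : C3 => ex_filterdiff (K := C_AbsRing) f (locally q)).

Definition Dx (f : C3 -> C) (p : C3) : C :=
  let '(x, y, z) := p in C_derive (fun t => f (t, y, z)) x.
Definition Dy (f : C3 -> C) (p : C3) : C :=
  let '(x, y, z) := p in C_derive (fun t => f (x, t, z)) y.
Definition Dz (f : C3 -> C) (p : C3) : C :=
  let '(x, y, z) := p in C_derive (fun t => f (x, y, t)) z.

(** [OneForm a b c] is a dx + b dy + c dz, and
    [TwoForm a b c] is a dy/\dz + b dz/\dx + c dx/\dy. *)
Record one_form := OneForm { c_dx : C3 -> C; c_dy : C3 -> C; c_dz : C3 -> C }.
Record two_form := TwoForm { c_dydz : C3 -> C; c_dzdx : C3 -> C; c_dxdy : C3 -> C }.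

Definition differential (f : C3 -> C) : one_form := OneForm (Dx f) (Dy f) (Dz f).

Definition ext_derivative (w : one_form) : two_form :=
  TwoForm (fun p => Dy (c_dz w) p - Dz (c_dy w) p)
          (fun p => Dz (c_dx w) p - Dx (c_dz w) p)
          (fun p => Dx (c_dy w) p - Dy (c_dx w) p).

Definition wedge11 (v w : one_form) : two_form :=
  TwoForm (fun p => c_dy v p * c_dz w p - c_dz v p * c_dy w p)
          (fun p => c_dz v p * c_dx w p - c_dx v p * c_dz w p)
          (fun p => c_dx v p * c_dy w p - c_dy v p * c_dx w p).

(** The coefficient of dx/\dy/\dz. *)
Definition wedge12 (v : one_form) (w : two_form) (p : C3) : C :=
  c_dx v p * c_dydz w p + c_dy v p * c_dzdx w p + c_dz v p * c_dxdy w p.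

Definition one_form_vanishes_at (w : one_form) (p : C3) : Prop :=
  c_dx w p = 0 /\ c_dy w p = 0 /\ c_dz w p = 0.

Definition two_form_vanishes_at (w : two_form) (p : C3) : Prop :=
  c_dydz w p = 0 /\ c_dzdx w p = 0 /\ c_dxdy w p = 0.

Definition contract (w : one_form) (X : C3 -> C3) (p : C3) : C :=
  let '(X1, X2, X3) := X p in c_dx w p * X1 + c_dy w p * X2 + c_dz w p * X3.

(** Near every point the coefficients have no common non-unit factor: this is
    the usual normalization saying that the singular set of w = 0 has
    codimension at least two. *)
Definition reduced (w : one_form) : Prop :=
  forall (p : C3) (g a b c : C3 -> C),
    holomorphic_near p g ->
    holomorphic_near p a -> holomorphic_near p b -> holomorphic_near p c ->
    locally p (fun q : C3 =>
      c_dx w q = g q * a q /\ c_dy w q = g q * b q /\ c_dz w q = g q * c q) ->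
    g p <> 0.

(** [w] = 0 defines a codimension one, possibly singular, holomorphic foliation
    of C^3.  On C^3 every such foliation is given by a global form. *)
Definition foliation (w : one_form) : Prop :=
  entire (c_dx w) /\ entire (c_dy w) /\ entire (c_dz w) /\
  (exists p, ~ one_form_vanishes_at w p) /\
  reduced w /\
  (forall p, wedge12 w (ext_derivative w) p = 0).

Definition tangent (X : C3 -> C3) (w : one_form) : Prop :=
  forall p, contract w X p = 0.

(** The meromorphic function H = P / Q is a first integral of w = 0. *)
Definition first_integral (w : one_form) (P Q : C3 -> C) : Prop :=
  entire P /\ entire Q /\
  (exists p q, Q p <> 0 /\ Q q <> 0 /\ P p / Q p <> P q / Q q) /\
  (forall p, Q p <> 0 ->
     two_form_vanishes_at (wedge11 (differential (fun q => P q / Q q)) w) p).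

Definition s_integrable (X : C3 -> C3) : Prop :=
  exists w : one_form,
    foliation w /\ tangent X w /\ exists P Q : C3 -> C, first_integral w P Q.

(** * Hill equations u'' + f(z) u = 0 *)

Definition hill_field (f : C -> C) (p : C3) : C3 :=
  let '(x, y, z) := p in (y, - (f z * x), RtoC 1).

Definition hill_equation_s_integrable (f : C -> C) : Prop :=
  s_integrable (hill_field f).

Definition hill_form (f : C -> C) : one_form :=
  OneForm (fun p => let '(x, y, z) := p in - y)
          (fun p => let '(x, y, z) := p in x)
          (fun p => let '(x, y, z) := p in y * y + f z * (x * x)).

(** The logarithm of w = 2 e^(z/2) that depends holomorphically on z in C and is
    real for real z: it lifts z |-> 2 e^(z/2) to the Riemann surface of the
    logarithm, and is the principal one for |Im z| < 2 pi. *)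
Definition log_arg (z : C) : C := RtoC (ln 2) + z / RtoC 2.

Lemma Cexp_log_arg (z : C) : Cexp (log_arg z) = RtoC 2 * Cexp (z / RtoC 2).
Proof.
  unfold log_arg, Cexp. destruct z as [a b].
  assert (E : forall u : C, Re (RtoC (ln 2) + u) = (ln 2 + Re u)%R /\
                            Im (RtoC (ln 2) + u) = Im u).
  { intros [u v]; simpl; split; ring. }
  destruct (E ((a, b) / RtoC 2)) as [-> ->].
  rewrite exp_plus, exp_ln by lra.
  apply injective_projections; simpl; ring.
Qed.

(** H = [H_num / H_den].  For J0 and Y0 taken at 2 e^(z/2) one has
    d J0/dz = - e^(z/2) J1 and d Y0/dz = - e^(z/2) Y1, so that the numerator and
    the denominator are, up to the factor 2, the Wronskians y u - x u' with the
    solutions u = Y0 and u = J0 of u'' + e^z u = 0; hence the plus signs. *)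
Definition H_num (p : C3) : C :=
  let '(x, y, z) := p in
  RtoC 2 * y * besselY 0 (log_arg z)
    + RtoC 2 * x * Cexp (z / RtoC 2) * besselY 1 (log_arg z).

Definition H_den (p : C3) : C :=
  let '(x, y, z) := p in
  y * besselJ (RtoC 0) (log_arg z)
    + x * Cexp (z / RtoC 2) * besselJ (RtoC 1) (log_arg z).

(* Main.v *)
Require Import Defs.
From Stdlib Require Import Reals Factorial Lra Lia.
From Coquelicot Require Import Coquelicot.

Local Open Scope C_scope.

(** Let u be a solution of u'' + e^z u = 0 and put v = - u', so that u' = - v and
    v' = e^z u.  The function P_u = y u + x v on C^3 has differential
    v dx + u dy + (- y v + e^z x u) dz, and for two solutions u1, u2 a direct
    computation gives P_u1 dP_u2 - P_u2 dP_u1 = (u2 v1 - u1 v2) omega.  Hence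
    d(P_u2 / P_u1) is proportional to omega.  With t = e^z, the numerator and
    the denominator of H are 2 P_u2 and P_u1 for u2 = Y0(2 e^(z/2)),
    v2 = e^(z/2) Y1(2 e^(z/2)) and u1 = J0(2 e^(z/2)), v1 = e^(z/2) J1(2 e^(z/2)),
    so everything rests on the equations u' = - v, v' = e^z u for these two pairs
    ([has_deriv_uJ], [has_deriv_vJ], [has_deriv_uY], [has_deriv_vY]).

    For the first kind they are identities between power series in t.  For the
    second kind one must first evaluate the limits nu --> 0 and nu --> 1 that
    define Y0 and Y1.  These are derivatives with respect to the order.  Near an
    integer m >= 0 the order m + x gives
      J_(m+x) = e^((m+x) z/2) / Gamma(1+x) sum_k (-1)^k t^k / (k! (1+x)...(k+m+x)),
    and the order -1 + x gives a similar formula with one more term.  The series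
    is differentiated in x term by term ([inv_rrising_expansion],
    [expands_gamma_sum]); 1/Gamma is differentiable at 1 by Euler's product
    ([expands_rGamma1p]).  The value gamma of that derivative, Euler's constant,
    enters Y0 as the coefficient of a multiple of the first solution.  The
    outcome is
      Y0 = (2/pi) ((gamma + z/2) sum a_k t^k - sum H_k a_k t^k),
      a_k = (-1)^k / k!^2,
    and a similar formula for e^(z/2) Y1 ([besselY_0], [besselY_1]).

    H is not constant because z |-> z + 2 pi i fixes e^z, hence u1, and adds
    2 i u1 to u2 ([uY_monodromy]): on the line x = 0, y = 1 it adds 4 i to H. *)

(** * First-order expansions *)

(** [f] is differentiable at increment 0 with value [a] and differential [L].
    The increments form an arbitrary type [T] measured by [N], so that one
    calculus serves the three situations that occur below: a real variation of
    the order of a Bessel function, a complex variation of z, and a variation of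
    a point of C^3. *)
Definition expands {T : Type} (N : T -> R) (f : T -> C) (a : C) (L : T -> C) : Prop :=
  (exists M : R, forall t, (Cmod (L t) <= M * N t)%R) /\
  forall eps : R, (0 < eps)%R -> exists d : R, (0 < d)%R /\
    forall t, (N t < d)%R -> (Cmod (f t - a - L t) <= eps * N t)%R.

Section Expansions.
Context {T : Type} (N : T -> R) (N_ge_0 : forall t, (0 <= N t)%R).

Lemma expands_ext (f g : T -> C) (a b : C) (L L' : T -> C) :
  expands N f a L -> (forall t, f t = g t) -> a = b -> (forall t, L t = L' t) ->
  expands N g b L'.
Proof.
  intros [[M HM] H] Hf <- HL; split.
  - exists M; intros t; rewrite <- HL; apply HM.
  - intros eps Heps; destruct (H eps Heps) as [d [Hd H']].
    exists d; split; [exact Hd|]; intros t Ht; rewrite <- Hf, <- HL; auto.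
Qed.

Lemma expands_ext_near (f g : T -> C) (a : C) (L : T -> C) (r : R) :
  (0 < r)%R -> (forall t, (N t < r)%R -> f t = g t) ->
  expands N f a L -> expands N g a L.
Proof.
  intros Hr Hf [HM H]; split; [exact HM|].
  intros eps Heps; destruct (H eps Heps) as [d [Hd H']].
  exists (Rmin d r); split; [apply Rmin_glb_lt; assumption|].
  intros t Ht; pose proof (Rmin_l d r); pose proof (Rmin_r d r).
  rewrite <- Hf by lra. apply H'; lra.
Qed.

Lemma expands_const (c : C) : expands N (fun _ => c) c (fun _ => RtoC 0).
Proof.
  split.
  - exists 0%R; intros t; rewrite Cmod_0; lra.
  - intros eps Heps; exists 1%R; split; [lra|]; intros t _.
    replace (c - c - RtoC 0) with (RtoC 0) by ring.
    rewrite Cmod_0; apply Rmult_le_pos; [lra|apply N_ge_0].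
Qed.

Lemma expands_linear (L : T -> C) (M : R) :
  (forall t, (Cmod (L t) <= M * N t)%R) -> expands N L 0 L.
Proof.
  intros HM; split; [exists M; exact HM|].
  intros eps Heps; exists 1%R; split; [lra|]; intros t _.
  replace (L t - 0 - L t) with (RtoC 0) by ring.
  rewrite Cmod_0; apply Rmult_le_pos; [lra|apply N_ge_0].
Qed.

Lemma expands_plus (f g : T -> C) (a b : C) (L L' : T -> C) :
  expands N f a L -> expands N g b L' ->
  expands N (fun t => f t + g t) (a + b) (fun t => L t + L' t).
Proof.
  intros [[M HM] H] [[M' HM'] H']; split.
  - exists (M + M')%R; intros t.
    eapply Rle_trans; [apply Cmod_triangle|]; specialize (HM t); specialize (HM' t); lra.
  - intros eps Heps.
    destruct (H (eps / 2)%R) as [d [Hd H1]]; [lra|].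
    destruct (H' (eps / 2)%R) as [d' [Hd' H2]]; [lra|].
    exists (Rmin d d'); split; [apply Rmin_glb_lt; assumption|].
    intros t Ht; pose proof (Rmin_l d d'); pose proof (Rmin_r d d').
    replace (f t + g t - (a + b) - (L t + L' t))
      with ((f t - a - L t) + (g t - b - L' t)) by ring.
    eapply Rle_trans; [apply Cmod_triangle|].
    specialize (H1 t ltac:(lra)); specialize (H2 t ltac:(lra)); lra.
Qed.

(** The increment of [f] is O(N): this is what controls the cross terms in the
    product rule and the argument of the outer function in the chain rule. *)
Lemma expands_lipschitz (f : T -> C) (a : C) (L : T -> C) :
  expands N f a L -> exists K d : R, (0 < K)%R /\ (0 < d)%R /\
    forall t, (N t < d)%R -> (Cmod (f t - a) <= K * N t)%R.
Proof.
  intros [[M HM] H]; destruct (H 1%R Rlt_0_1) as [d [Hd H1]].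
  exists (Rabs M + 1)%R, d; split; [pose proof (Rabs_pos M); lra|]; split; [exact Hd|].
  intros t Ht; replace (f t - a) with ((f t - a - L t) + L t) by ring.
  eapply Rle_trans; [apply Cmod_triangle|].
  specialize (H1 t Ht); specialize (HM t).
  pose proof (N_ge_0 t); pose proof (Rle_abs M).
  assert (M * N t <= Rabs M * N t)%R by (apply Rmult_le_compat_r; lra). lra.
Qed.

Lemma expands_comp (phi : C -> C) (l a : C) (f : T -> C) (L : T -> C) :
  expands Cmod (fun h => phi (a + h)) (phi a) (fun h => l * h) ->
  expands N f a L ->
  expands N (fun t => phi (f t)) (phi a) (fun t => l * L t).
Proof.
  intros [_ Hphi] Hf.
  destruct (expands_lipschitz _ _ _ Hf) as [K [d0 [HK [Hd0 HL]]]].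
  destruct Hf as [[M HM] H]; split.
  - exists (Cmod l * M)%R; intros t; rewrite Cmod_mult.
    rewrite Rmult_assoc; apply Rmult_le_compat_l; [apply Cmod_ge_0|apply HM].
  - intros eps Heps.
    destruct (Hphi (eps / (2 * K))%R) as [d1 [Hd1 H1]];
      [apply Rdiv_lt_0_compat; lra|].
    pose proof (Cmod_ge_0 l) as Hl.
    destruct (H (eps / (2 * (Cmod l + 1)))%R) as [d2 [Hd2 H2]];
      [apply Rdiv_lt_0_compat; lra|].
    exists (Rmin d0 (Rmin (d1 / K) d2)); split.
    { repeat apply Rmin_glb_lt; try assumption. apply Rdiv_lt_0_compat; lra. }
    intros t Ht.
    assert (A0 : (N t < d0)%R) by (eapply Rlt_le_trans; [exact Ht|apply Rmin_l]).
    assert (A12 : (N t < Rmin (d1 / K) d2)%R)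
      by (eapply Rlt_le_trans; [exact Ht|apply Rmin_r]).
    assert (A1 : (N t < d1 / K)%R) by (eapply Rlt_le_trans; [exact A12|apply Rmin_l]).
    assert (A2 : (N t < d2)%R) by (eapply Rlt_le_trans; [exact A12|apply Rmin_r]).
    specialize (HL t A0); specialize (H2 t A2).
    assert (B : (Cmod (f t - a) < d1)%R).
    { eapply Rle_lt_trans; [exact HL|].
      replace d1 with (K * (d1 / K))%R by (field; lra).
      apply Rmult_lt_compat_l; assumption. }
    specialize (H1 _ B).
    replace (a + (f t - a)) with (f t) in H1 by ring.
    replace (phi (f t) - phi a - l * L t)
      with ((phi (f t) - phi a - l * (f t - a)) + l * (f t - a - L t)) by ring.
    eapply Rle_trans; [apply Cmod_triangle|]. rewrite Cmod_mult.
    pose proof (N_ge_0 t) as HN.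
    assert (C1 : (eps / (2 * K) * Cmod (f t - a) <= eps / 2 * N t)%R).
    { replace (eps / 2 * N t)%R with (eps / (2 * K) * (K * N t))%R by (field; lra).
      apply Rmult_le_compat_l; [|exact HL].
      apply Rlt_le, Rdiv_lt_0_compat; lra. }
    assert (C2 : (Cmod l * Cmod (f t - a - L t) <= eps / 2 * N t)%R).
    { eapply Rle_trans; [apply Rmult_le_compat_l; [exact Hl|exact H2]|].
      replace (eps / 2 * N t)%R
        with ((Cmod l + 1) * (eps / (2 * (Cmod l + 1)) * N t))%R by (field; lra).
      apply Rmult_le_compat_r; [|lra].
      apply Rmult_le_pos; [apply Rlt_le, Rdiv_lt_0_compat; lra|exact HN]. }
    lra.
Qed.

Lemma expands_mult (f g : T -> C) (a b : C) (L L' : T -> C) :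
  expands N f a L -> expands N g b L' ->
  expands N (fun t => f t * g t) (a * b) (fun t => L t * b + a * L' t).
Proof.
  intros Hf Hg.
  destruct (expands_lipschitz _ _ _ Hg) as [K [d0 [HK [Hd0 HK']]]].
  destruct Hf as [[M HM] H], Hg as [[M' HM'] H']; split.
  - exists (M * Cmod b + Cmod a * M')%R; intros t.
    eapply Rle_trans; [apply Cmod_triangle|]; rewrite 2!Cmod_mult.
    pose proof (Rmult_le_compat_r (Cmod b) _ _ (Cmod_ge_0 b) (HM t)).
    pose proof (Rmult_le_compat_l (Cmod a) _ _ (Cmod_ge_0 a) (HM' t)). lra.
  - intros eps Heps.
    pose proof (Cmod_ge_0 a) as Ha; pose proof (Cmod_ge_0 b) as Hb.
    set (B := (Cmod b + K)%R).
    assert (HB : (0 < B)%R) by (unfold B; lra).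
    (* Each of the three error terms is made at most eps/3 times [N t]. *)
    destruct (H (eps / (3 * B))%R) as [d1 [Hd1 H1]]; [apply Rdiv_lt_0_compat; lra|].
    destruct (H' (eps / (3 * (Cmod a + 1)))%R) as [d2 [Hd2 H2]];
      [apply Rdiv_lt_0_compat; lra|].
    set (M1 := (Rabs M + 1)%R).
    assert (HM1 : (0 < M1)%R) by (unfold M1; pose proof (Rabs_pos M); lra).
    set (d3 := (eps / (3 * M1 * K))%R).
    assert (Hd3 : (0 < d3)%R)
      by (apply Rdiv_lt_0_compat; [lra|]; repeat apply Rmult_lt_0_compat; lra).
    exists (Rmin (Rmin d0 1) (Rmin d1 (Rmin d2 d3))); split.
    { repeat apply Rmin_glb_lt; try assumption; lra. }
    intros t Ht.
    pose proof (Rmin_l (Rmin d0 1) (Rmin d1 (Rmin d2 d3))).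
    pose proof (Rmin_r (Rmin d0 1) (Rmin d1 (Rmin d2 d3))).
    pose proof (Rmin_l d0 1). pose proof (Rmin_r d0 1).
    pose proof (Rmin_l d1 (Rmin d2 d3)). pose proof (Rmin_r d1 (Rmin d2 d3)).
    pose proof (Rmin_l d2 d3). pose proof (Rmin_r d2 d3).
    specialize (H1 t ltac:(lra)); specialize (H2 t ltac:(lra)).
    specialize (HK' t ltac:(lra)); pose proof (N_ge_0 t) as HN.
    replace (f t * g t - a * b - (L t * b + a * L' t))
      with ((f t - a - L t) * g t + (a * (g t - b - L' t) + L t * (g t - b))) by ring.
    eapply Rle_trans; [apply Cmod_triangle|].
    eapply Rle_trans; [apply Rplus_le_compat_l, Cmod_triangle|].
    rewrite 3!Cmod_mult.
    assert (Hg : (Cmod (g t) <= B)%R).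
    { replace (g t) with (b + (g t - b)) by ring.
      eapply Rle_trans; [apply Cmod_triangle|]; unfold B.
      assert (K * N t <= K * 1)%R by (apply Rmult_le_compat_l; lra). lra. }
    assert (C1 : (Cmod (f t - a - L t) * Cmod (g t) <= eps / 3 * N t)%R).
    { replace (eps / 3 * N t)%R with (eps / (3 * B) * N t * B)%R by (field; lra).
      apply Rmult_le_compat; auto using Cmod_ge_0. }
    assert (C2 : (Cmod a * Cmod (g t - b - L' t) <= eps / 3 * N t)%R).
    { eapply Rle_trans; [apply Rmult_le_compat_l; [exact Ha|exact H2]|].
      replace (eps / 3 * N t)%R
        with ((Cmod a + 1) * (eps / (3 * (Cmod a + 1)) * N t))%R by (field; lra).
      apply Rmult_le_compat_r; [|lra].
      apply Rmult_le_pos; [apply Rlt_le, Rdiv_lt_0_compat; lra|exact HN]. }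
    assert (C3 : (Cmod (L t) * Cmod (g t - b) <= eps / 3 * N t)%R).
    { assert (HL : (Cmod (L t) <= M1 * N t)%R).
      { eapply Rle_trans; [apply HM|]. apply Rmult_le_compat_r; [exact HN|].
        unfold M1; pose proof (Rle_abs M); lra. }
      apply Rle_trans with (M1 * N t * (K * N t))%R;
        [apply Rmult_le_compat; auto using Cmod_ge_0|].
      replace (eps / 3 * N t)%R with (M1 * K * N t * d3)%R
        by (unfold d3; field; split; lra).
      replace (M1 * N t * (K * N t))%R with (M1 * K * N t * N t)%R by ring.
      apply Rmult_le_compat_l; [|lra].
      repeat apply Rmult_le_pos; lra. }
    lra.
Qed.

Lemma expands_scal (c : C) (f : T -> C) (a : C) (L : T -> C) :
  expands N f a L -> expands N (fun t => c * f t) (c * a) (fun t => c * L t).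
Proof.
  intros Hf. eapply expands_ext.
  - apply expands_mult; [apply (expands_const c)|exact Hf].
  - reflexivity.
  - reflexivity.
  - intros t; simpl; ring.
Qed.

Lemma expands_minus (f g : T -> C) (a b : C) (L L' : T -> C) :
  expands N f a L -> expands N g b L' ->
  expands N (fun t => f t - g t) (a - b) (fun t => L t - L' t).
Proof.
  intros Hf Hg. eapply expands_ext.
  - apply expands_plus; [exact Hf|apply (expands_scal (-(1)) _ _ _ Hg)].
  - intros t; simpl; ring.
  - ring.
  - intros t; simpl; ring.
Qed.

End Expansions.

Lemma expands_Cinv (a : C) :
  a <> 0 -> expands Cmod (fun h => / (a + h)) (/ a) (fun h => - (/ a * / a) * h).
Proof.
  intros Ha; split.
  - eexists; intros h; rewrite Cmod_mult; apply Rle_refl.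
  - intros eps Heps.
    pose proof (proj1 (Cmod_gt_0 a) Ha) as Hm.
    set (m := Cmod a) in *.
    exists (Rmin (m / 2) (eps * (m * m * m) / 2)); split.
    { apply Rmin_glb_lt; [lra|]. apply Rdiv_lt_0_compat; [|lra].
      repeat apply Rmult_lt_0_compat; assumption. }
    intros h Hh.
    pose proof (Rmin_l (m / 2) (eps * (m * m * m) / 2)).
    pose proof (Rmin_r (m / 2) (eps * (m * m * m) / 2)).
    assert (Hah : (m / 2 <= Cmod (a + h))%R).
    { pose proof (Cmod_triangle (a + h) (- h)) as Q.
      replace (a + h + - h) with a in Q by ring. rewrite Cmod_opp in Q.
      fold m in Q. lra. }
    assert (Hne : a + h <> 0).
    { intros E; rewrite E, Cmod_0 in Hah; lra. }
    replace (/ (a + h) - / a - - (/ a * / a) * h) with (h * h / (a * a * (a + h)))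
      by (field; split; assumption).
    rewrite Cmod_div by (repeat apply Cmult_neq_0; assumption).
    rewrite !Cmod_mult; fold m.
    pose proof (Cmod_ge_0 h).
    apply Rle_div_l; [repeat apply Rmult_lt_0_compat; lra|].
    replace (eps * Cmod h * (m * m * Cmod (a + h)))%R
      with (Cmod h * (eps * (m * m) * Cmod (a + h)))%R by ring.
    apply Rmult_le_compat_l; [assumption|].
    apply Rle_trans with (eps * (m * m) * (m / 2))%R; [lra|].
    apply Rmult_le_compat_l; [|assumption].
    repeat apply Rmult_le_pos; lra.
Qed.

Lemma expands_div {T : Type} (N : T -> R) (f g : T -> C) (a b : C) (L L' : T -> C) :
  (forall t, (0 <= N t)%R) -> b <> 0 ->
  expands N f a L -> expands N g b L' ->
  expands N (fun t => f t / g t) (a / b) (fun t => (L t * b - a * L' t) / (b * b)).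
Proof.
  intros HN Hb Hf Hg. eapply expands_ext.
  - apply expands_mult; [exact HN|exact Hf|].
    apply (expands_comp N HN (fun w => / w)); [apply expands_Cinv; exact Hb|exact Hg].
  - reflexivity.
  - reflexivity.
  - intros t; simpl; field; exact Hb.
Qed.

(** A change of increments that is O(N) preserves expansions: it serves to
    restrict an expansion to a line and to view a function of one coordinate as
    a function of several. *)
Lemma expands_precomp {S T : Type} (NS : S -> R) (NT : T -> R) (p : T -> S) (K : R)
    (f : S -> C) (a : C) (L : S -> C) :
  (0 < K)%R -> (forall t, (0 <= NS (p t) <= K * NT t)%R) ->
  expands NS f a L -> expands NT (fun t => f (p t)) a (fun t => L (p t)).
Proof.
  intros HK Hp [[M HM] H]; split.
  - exists (Rabs M * K)%R; intros t. eapply Rle_trans; [apply HM|].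
    destruct (Hp t) as [H0 H1]. pose proof (Rle_abs M). pose proof (Rabs_pos M).
    apply Rle_trans with (Rabs M * NS (p t))%R; [apply Rmult_le_compat_r; lra|].
    rewrite Rmult_assoc; apply Rmult_le_compat_l; lra.
  - intros eps Heps. destruct (H (eps / K)%R) as [d [Hd H1]]; [apply Rdiv_lt_0_compat; lra|].
    exists (d / K)%R; split; [apply Rdiv_lt_0_compat; lra|].
    intros t Ht. destruct (Hp t) as [H2 H3].
    assert (K * NT t < d)%R.
    { replace d with (K * (d / K))%R by (field; lra). apply Rmult_lt_compat_l; lra. }
    eapply Rle_trans; [apply H1; lra|].
    apply Rle_trans with (eps / K * (K * NT t))%R.
    + apply Rmult_le_compat_l; [apply Rlt_le, Rdiv_lt_0_compat; lra|lra].
    + apply Req_le; field; lra.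
Qed.

Lemma expands_RtoC (f : R -> R) (x l : R) :
  is_derive f x l ->
  expands Rabs (fun h => RtoC (f (x + h)%R)) (f x) (fun h => RtoC l * RtoC h).
Proof.
  intros [_ H]; split.
  - exists (Rabs l); intros t; rewrite <- RtoC_mult, Cmod_R, Rabs_mult; lra.
  - intros eps Heps.
    destruct (H x (fun P HP => HP) (mkposreal eps Heps)) as [d Hd].
    exists d; split; [apply cond_pos|]; intros h Hh.
    rewrite <- RtoC_mult, <- !RtoC_minus, Cmod_R.
    specialize (Hd (x + h)%R). simpl in Hd.
    unfold norm, minus, plus, opp, scal in Hd; simpl in Hd.
    unfold abs, mult in Hd; simpl in Hd.
    replace (x + h + - x)%R with h in Hd by ring.
    replace (f (x + h) - f x - l * h)%R with (f (x + h) + - f x + - (h * l))%R by ring.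
    apply Hd. unfold ball; simpl; unfold AbsRing_ball, abs, minus, plus, opp; simpl.
    replace (x + h + - x)%R with h by ring. exact Hh.
Qed.

Lemma Cexp_plus (z w : C) : Cexp (z + w) = Cexp z * Cexp w.
Proof.
  destruct z as [a b], w as [c d]; unfold Cexp; simpl.
  rewrite exp_plus, cos_plus, sin_plus.
  apply injective_projections; simpl; ring.
Qed.

Lemma Cexp_RtoC (x : R) : Cexp x = RtoC (exp x).
Proof.
  unfold Cexp; simpl; rewrite cos_0, sin_0.
  apply injective_projections; simpl; ring.
Qed.

Lemma im_le_Cmod (h : C) : (Rabs (Im h) <= Cmod h)%R.
Proof.
  eapply Rle_trans; [apply Rmax_r|apply Rmax_Cmod].
Qed.

(** By the functional equation it is enough to expand at 0, where
    exp (a + i b) = exp a (cos b + i sin b) reduces the claim to the real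
    derivatives of exp, cos and sin at 0. *)
Lemma expands_Cexp (z : C) :
  expands Cmod (fun h => Cexp (z + h)) (Cexp z) (fun h => Cexp z * h).
Proof.
  assert (N0 : forall h : C, (0 <= Rabs (Re h) <= 1 * Cmod h)%R).
  { intros h; split; [apply Rabs_pos|]; rewrite Rmult_1_l; apply re_le_Cmod. }
  assert (N1 : forall h : C, (0 <= Rabs (Im h) <= 1 * Cmod h)%R).
  { intros h; split; [apply Rabs_pos|]; rewrite Rmult_1_l; apply im_le_Cmod. }
  assert (E : expands Cmod (fun h => RtoC (exp (0 + Re h))) (exp 0)
                (fun h => RtoC (exp 0) * RtoC (Re h))).
  { apply (expands_precomp Rabs Cmod Re 1 (fun x => RtoC (exp (0 + x)))
             (exp 0) (fun x => RtoC (exp 0) * RtoC x)); auto using Rlt_0_1.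
    apply expands_RtoC, is_derive_exp. }
  assert (Ec : expands Cmod (fun h => RtoC (cos (0 + Im h))) (cos 0)
                (fun h => RtoC (- sin 0) * RtoC (Im h))).
  { apply (expands_precomp Rabs Cmod Im 1 (fun x => RtoC (cos (0 + x)))
             (cos 0) (fun x => RtoC (- sin 0) * RtoC x)); auto using Rlt_0_1.
    apply expands_RtoC, is_derive_cos. }
  assert (Es : expands Cmod (fun h => RtoC (sin (0 + Im h))) (sin 0)
                (fun h => RtoC (cos 0) * RtoC (Im h))).
  { apply (expands_precomp Rabs Cmod Im 1 (fun x => RtoC (sin (0 + x)))
             (sin 0) (fun x => RtoC (cos 0) * RtoC x)); auto using Rlt_0_1.
    apply expands_RtoC, is_derive_sin. }
  rewrite exp_0 in E; rewrite cos_0, sin_0 in Ec, Es.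
  eapply expands_ext.
  - apply (expands_scal Cmod Cmod_ge_0 (Cexp z)).
    apply (expands_mult Cmod Cmod_ge_0); [exact E|].
    apply (expands_plus Cmod); [exact Ec|].
    apply (expands_scal Cmod Cmod_ge_0 Ci); exact Es.
  - intros h; simpl. rewrite Cexp_plus; f_equal.
    destruct h as [a b]; unfold Cexp; simpl. rewrite !Rplus_0_l.
    apply injective_projections; simpl; ring.
  - ring.
  - intros h; simpl. f_equal. destruct h as [a b]. apply injective_projections; simpl; ring.
Qed.

(** * Complex series and their termwise differentiation *)

Lemma sum_n_RtoC (u : nat -> R) (n : nat) :
  sum_n (fun k => RtoC (u k)) n = RtoC (sum_n u n).
Proof.
  induction n as [|n IH]; [rewrite !sum_O; reflexivity|].
  rewrite !sum_Sn, IH. unfold plus; simpl. rewrite RtoC_plus; reflexivity.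
Qed.

Lemma is_series_RtoC (u : nat -> R) (l : R) :
  is_series u l -> is_series (fun k => RtoC (u k)) (RtoC l).
Proof.
  intros H. unfold is_series in *.
  apply filterlim_ext with (fun n => RtoC (sum_n u n)).
  - intros n; symmetry; apply sum_n_RtoC.
  - apply filterlim_comp with (1 := H). intros P [e He].
    exists e; intros y Hy; apply He.
    split; [exact Hy|apply ball_center].
Qed.

Lemma C_lim_seq_RtoC (u : nat -> R) (l : R) :
  is_lim_seq u l -> C_lim_seq (fun n => RtoC (u n)) = RtoC l.
Proof.
  intros H; unfold C_lim_seq.
  rewrite (is_lim_seq_unique (fun n => Re (u n)) l H).
  rewrite (is_lim_seq_unique (fun n => Im (u n)) 0%R (is_lim_seq_const 0%R)).
  reflexivity.
Qed.

Lemma C_Series_unique (u : nat -> C) (l : C) : is_series u l -> C_Series u = l.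
Proof.
  intros H; unfold C_Series, C_lim_seq.
  assert (H1 : is_lim_seq (fun n => Re (sum_n u n)) (Re l)).
  { apply filterlim_comp with (1 := H). intros P [e He].
    exists e; intros y Hy; apply He, Hy. }
  assert (H2 : is_lim_seq (fun n => Im (sum_n u n)) (Im l)).
  { apply filterlim_comp with (1 := H). intros P [e He].
    exists e; intros y Hy; apply He, Hy. }
  rewrite (is_lim_seq_unique _ _ H1), (is_lim_seq_unique _ _ H2).
  destruct l; reflexivity.
Qed.

Lemma is_series_C_ext (u v : nat -> C) (l : C) :
  (forall k, u k = v k) -> is_series u l -> is_series v l.
Proof. intros H1 H2; exact (is_series_ext u v l H1 H2). Qed.

Lemma is_series_C_scal (c : C) (u : nat -> C) (l : C) :
  is_series u l -> is_series (fun k => c * u k) (c * l).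
Proof. intros H; exact (is_series_scal c u l H). Qed.

Lemma is_series_C_plus (u v : nat -> C) (l m : C) :
  is_series u l -> is_series v m -> is_series (fun k => u k + v k) (l + m).
Proof. intros H1 H2; exact (is_series_plus u v l m H1 H2). Qed.

Lemma is_series_C_shift (u : nat -> C) (l : C) :
  is_series (fun k => u (S k)) l <-> is_series u (u O + l).
Proof.
  split; intros H.
  - apply is_series_decr_1.
    match goal with |- is_series _ ?x => replace x with l end; [exact H|].
    unfold plus, opp; simpl; ring.
  - apply is_series_incr_1.
    match goal with |- is_series _ ?x => replace x with (u O + l) end; [exact H|].
    unfold plus; simpl; ring.
Qed.

Lemma is_series_C_minus (u v : nat -> C) (l m : C) :
  is_series u l -> is_series v m -> is_series (fun k => u k - v k) (l - m).
Proof. intros H1 H2; exact (is_series_minus u v l m H1 H2). Qed.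

Lemma ex_series_C_dominated (u : nat -> C) (m : nat -> R) :
  (forall k, (Cmod (u k) <= m k)%R) -> ex_series m -> exists l, is_series u l.
Proof.
  intros H1 H2.
  destruct (ex_series_le u m) as [l Hl]; [|exact H2|exists l; exact Hl].
  exact H1.
Qed.

Lemma is_series_C_Cmod_le (u : nat -> C) (l : C) (m : nat -> R) (s : R) :
  is_series u l -> is_series m s -> (forall k, (Cmod (u k) <= m k)%R) ->
  (Cmod l <= s)%R.
Proof.
  intros Hu Hm H.
  assert (Hn : is_lim_seq (fun n => Cmod (sum_n u n)) (Cmod l)).
  { exact (filterlim_comp _ _ _ (sum_n u) norm _ _ _ Hu (filterlim_norm l)). }
  refine (is_lim_seq_le _ _ (Cmod l) s _ Hn Hm).
  intros n; induction n as [|n IH].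
  - rewrite !sum_O; apply H.
  - rewrite !sum_Sn. eapply Rle_trans; [apply Cmod_triangle|].
    apply Rplus_le_compat; [exact IH|apply H].
Qed.

(** A series is differentiable term by term as soon as the remainders of order
    two of its terms are dominated by M_k N^2 with a summable sequence M: the
    sum S of the M_k gives |F - A - L'| <= S N^2. *)
Lemma expands_series {T : Type} (N : T -> R) (f : nat -> T -> C) (F : T -> C)
    (a : nat -> C) (A : C) (L : nat -> T -> C) (L' : T -> C) (M : nat -> R) (r : R) :
  (forall t, (0 <= N t)%R) -> (0 < r)%R ->
  (forall t, (N t < r)%R -> is_series (fun k => f k t) (F t)) ->
  is_series a A ->
  (forall t, is_series (fun k => L k t) (L' t)) ->
  (exists B, forall t, (Cmod (L' t) <= B * N t)%R) ->
  ex_series M ->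
  (forall k t, (N t < r)%R -> (Cmod (f k t - a k - L k t) <= M k * (N t * N t))%R) ->
  expands N F A L'.
Proof.
  intros HN Hr HF HA HL HB [s Hs] Hrem; split; [exact HB|].
  intros eps Heps.
  exists (Rmin r (eps / (Rabs s + 1))); split.
  { apply Rmin_glb_lt; [exact Hr|]. apply Rdiv_lt_0_compat; [lra|].
    pose proof (Rabs_pos s); lra. }
  intros t Ht.
  pose proof (Rmin_l r (eps / (Rabs s + 1))); pose proof (Rmin_r r (eps / (Rabs s + 1))).
  assert (H1 : (Cmod (F t - A - L' t) <= s * (N t * N t))%R).
  { eapply is_series_C_Cmod_le.
    - apply is_series_C_minus; [apply is_series_C_minus|].
      + apply HF; lra.
      + exact HA.
      + apply HL.
    - apply (is_series_scal_r (N t * N t)%R), Hs.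
    - intros k; simpl. apply (Hrem k t); lra. }
  eapply Rle_trans; [exact H1|].
  pose proof (HN t). pose proof (Rle_abs s). pose proof (Rabs_pos s).
  apply Rle_trans with ((Rabs s + 1) * N t * N t)%R.
  - replace (s * (N t * N t))%R with (s * N t * N t)%R by ring.
    apply Rmult_le_compat_r; [lra|]. apply Rmult_le_compat_r; lra.
  - apply Rmult_le_compat_r; [lra|].
    apply Rle_trans with ((Rabs s + 1) * (eps / (Rabs s + 1)))%R.
    + apply Rmult_le_compat_l; lra.
    + apply Req_le; field; lra.
Qed.

Lemma ex_series_pow_fact (B K : R) :
  ex_series (fun k => (B * (K ^ k / INR (fact k)))%R).
Proof.
  exists (B * exp K)%R.
  apply (is_series_scal_l (K := R_AbsRing) B (fun k => (K ^ k / INR (fact k))%R)).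
  apply is_series_ext with (2 := is_exp_Reals K).
  intros k; rewrite pow_n_pow. unfold scal; simpl; unfold mult; simpl. reflexivity.
Qed.

Lemma INR_le_pow2 (k : nat) : (INR k <= 2 ^ k)%R.
Proof.
  induction k as [|k IH]; [simpl; lra|].
  rewrite S_INR; simpl. assert (1 <= 2 ^ k)%R by (apply pow_R1_Rle; lra). lra.
Qed.

(** The remainder s_k of order two of (t + h)^k satisfies
    s_(k+1) = (t + h) s_k + k t^(k-1) h^2, and induction gives a bound that
    grows only geometrically with k. *)
Lemma pow_increment_Cmod_le (t h : C) (k : nat) :
  (Cmod h <= 1)%R ->
  (Cmod ((t + h) ^ k - t ^ k - RtoC (INR k) * t ^ Nat.pred k * h)
     <= (4 * (Cmod t + 1)) ^ k * (Cmod h * Cmod h))%R.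
Proof.
  intros Hh. pose proof (Cmod_ge_0 t) as Ht. pose proof (Cmod_ge_0 h) as Hh0.
  set (R := (Cmod t + 1)%R).
  assert (HR : (1 <= R)%R) by (unfold R; lra).
  assert (Hth : (Cmod (t + h) <= R)%R)
    by (eapply Rle_trans; [apply Cmod_triangle|unfold R; lra]).
  induction k as [|k IH].
  - simpl. replace (1 - 1 - 0 * 1 * h) with (RtoC 0) by ring. rewrite Cmod_0.
    pose proof (Rmult_le_pos _ _ Hh0 Hh0); lra.
  - set (s := (t + h) ^ k - t ^ k - INR k * t ^ Nat.pred k * h) in *.
    replace ((t + h) ^ S k - t ^ S k - INR (S k) * t ^ Nat.pred (S k) * h)
      with ((t + h) * s + INR k * t ^ Nat.pred k * (h * h)).
    2:{ unfold s. rewrite S_INR, RtoC_plus. simpl Nat.pred. destruct k as [|k].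
        - simpl. ring.
        - simpl Nat.pred. rewrite !Cpow_S. ring. }
    eapply Rle_trans; [apply Cmod_triangle|]. rewrite !Cmod_mult, Cmod_R, Cmod_pow.
    rewrite (Rabs_pos_eq (INR k)) by apply pos_INR.
    set (q := (Cmod h * Cmod h)%R) in *. assert (Hq : (0 <= q)%R) by (unfold q; nra).
    assert (H4 : (0 <= (4 * R) ^ k)%R) by (apply pow_le; lra).
    assert (A1 : (Cmod (t + h) * Cmod s <= R * ((4 * R) ^ k * q))%R)
      by (apply Rmult_le_compat; auto using Cmod_ge_0).
    assert (A2 : (Cmod t ^ Nat.pred k <= R ^ k)%R).
    { apply Rle_trans with (R ^ Nat.pred k)%R.
      - apply pow_incr; unfold R; lra.
      - apply Rle_pow; [exact HR|lia]. }
    assert (A3 : (INR k * Cmod t ^ Nat.pred k <= (4 * R) ^ k)%R).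
    { rewrite Rpow_mult_distr. apply Rmult_le_compat; auto using pos_INR, pow_le.
      eapply Rle_trans; [apply INR_le_pow2|]. apply pow_incr; lra. }
    assert (A4 : (INR k * Cmod t ^ Nat.pred k * q <= (4 * R) ^ k * q)%R)
      by (apply Rmult_le_compat_r; assumption).
    assert (A5 : ((4 * R) ^ k * q <= R * ((4 * R) ^ k * q))%R).
    { rewrite <- (Rmult_1_l ((4 * R) ^ k * q)) at 1.
      apply Rmult_le_compat_r; [apply Rmult_le_pos|]; assumption. }
    change ((4 * R) ^ S k)%R with (4 * R * (4 * R) ^ k)%R.
    assert (0 <= R * ((4 * R) ^ k * q))%R by (repeat apply Rmult_le_pos; lra).
    nra.
Qed.

(** All the series below have coefficients O(K^k / k!); their sums are entire,
    and the class is stable under differentiation. *)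
Definition exp_bounded (c : nat -> C) : Prop :=
  exists B K : R, (0 <= B)%R /\ (0 <= K)%R /\
    forall k, (Cmod (c k) <= B * (K ^ k / INR (fact k)))%R.

Definition power_sum (c : nat -> C) (t : C) : C := C_Series (fun k => c k * t ^ k).

Lemma power_sum_correct (c : nat -> C) (t : C) :
  exp_bounded c -> is_series (fun k => c k * t ^ k) (power_sum c t).
Proof.
  intros [B [K [HB [HK H]]]].
  destruct (ex_series_C_dominated (fun k => c k * t ^ k)
              (fun k => (B * ((K * Cmod t) ^ k / INR (fact k)))%R)) as [l Hl].
  - intros k; rewrite Cmod_mult, Cmod_pow, Rpow_mult_distr.
    replace (B * (K ^ k * Cmod t ^ k / INR (fact k)))%R
      with (B * (K ^ k / INR (fact k)) * Cmod t ^ k)%R by (unfold Rdiv; ring).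
    apply Rmult_le_compat_r; [apply pow_le, Cmod_ge_0|apply H].
  - apply ex_series_pow_fact.
  - unfold power_sum; rewrite (C_Series_unique _ _ Hl); exact Hl.
Qed.

Definition derived_coef (c : nat -> C) (k : nat) : C := RtoC (INR (S k)) * c (S k).

Lemma exp_bounded_derived (c : nat -> C) : exp_bounded c -> exp_bounded (derived_coef c).
Proof.
  intros [B [K [HB [HK H]]]]. exists (B * K)%R, K; split; [nra|]; split; [exact HK|].
  intros k; unfold derived_coef. rewrite Cmod_mult, Cmod_R.
  rewrite Rabs_pos_eq by apply pos_INR.
  eapply Rle_trans; [apply Rmult_le_compat_l; [apply pos_INR|apply H]|].
  apply Req_le. rewrite fact_simpl, mult_INR. simpl pow. field.
  split; [apply INR_fact_neq_0|apply not_0_INR; lia].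
Qed.

Lemma expands_power_sum (c : nat -> C) (t : C) :
  exp_bounded c ->
  expands Cmod (fun h => power_sum c (t + h)) (power_sum c t)
    (fun h => power_sum (derived_coef c) t * h).
Proof.
  intros Hc. pose proof Hc as [B [K [HB [HK H]]]].
  apply expands_series with
    (f := fun k h => c k * (t + h) ^ k)
    (a := fun k => c k * t ^ k)
    (L := fun k h => c k * (RtoC (INR k) * t ^ Nat.pred k) * h)
    (M := fun k => (B * ((K * (4 * (Cmod t + 1))) ^ k / INR (fact k)))%R)
    (r := 1%R).
  - apply Cmod_ge_0.
  - apply Rlt_0_1.
  - intros h _; apply power_sum_correct, Hc.
  - apply power_sum_correct, Hc.
  - intros h.
    apply is_series_C_ext with
      (fun k => h * (c k * (RtoC (INR k) * t ^ Nat.pred k))); [intros k; ring|].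
    rewrite (Cmult_comm _ h). apply is_series_C_scal.
    replace (power_sum (derived_coef c) t)
      with (c O * (RtoC (INR O) * t ^ Nat.pred O) + power_sum (derived_coef c) t)
      by (simpl; ring).
    apply (proj1 (is_series_C_shift (fun k => c k * (RtoC (INR k) * t ^ Nat.pred k)) _)).
    apply is_series_C_ext with (fun k => derived_coef c k * t ^ k).
    + intros k; unfold derived_coef; simpl Nat.pred; ring.
    + apply power_sum_correct, exp_bounded_derived, Hc.
  - eexists; intros h; rewrite Cmod_mult; apply Rle_refl.
  - apply ex_series_pow_fact.
  - intros k h Hh.
    replace (c k * (t + h) ^ k - c k * t ^ k - c k * (INR k * t ^ Nat.pred k) * h)
      with (c k * ((t + h) ^ k - t ^ k - INR k * t ^ Nat.pred k * h)) by ring.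
    rewrite Cmod_mult, Rpow_mult_distr.
    replace (B * (K ^ k * (4 * (Cmod t + 1)) ^ k / INR (fact k)) * (Cmod h * Cmod h))%R
      with (B * (K ^ k / INR (fact k)) *
            ((4 * (Cmod t + 1)) ^ k * (Cmod h * Cmod h)))%R by (unfold Rdiv; ring).
    apply Rmult_le_compat; auto using Cmod_ge_0.
    apply pow_increment_Cmod_le; lra.
Qed.

(** * The Gamma function at real arguments *)

Fixpoint rrising (s : R) (n : nat) : R :=
  match n with
  | O => 1%R
  | S m => (rrising s m * (s + INR m))%R
  end.

Lemma rising_RtoC (s : R) (n : nat) : rising (RtoC s) n = RtoC (rrising s n).
Proof.
  induction n as [|n IH]; [reflexivity|].
  simpl. rewrite IH, <- RtoC_plus, <- RtoC_mult. reflexivity.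
Qed.

Lemma RtoC_Rinv (x : R) : RtoC (/ x) = / RtoC x.
Proof.
  destruct (Req_dec x 0) as [->|H]; [|apply RtoC_inv, H].
  rewrite Rinv_0. apply injective_projections; simpl; unfold Rdiv; ring.
Qed.

Lemma RtoC_Rdiv (x y : R) : RtoC (x / y) = RtoC x / RtoC y.
Proof. unfold Rdiv, Cdiv. rewrite RtoC_mult, RtoC_Rinv. reflexivity. Qed.

Definition gauss_seq (s : R) (n : nat) : R :=
  (INR (fact n) * exp (s * ln (INR n)) / rrising s (S n))%R.

Lemma CGamma_RtoC (s l : R) :
  is_lim_seq (gauss_seq s) l -> CGamma (RtoC s) = RtoC l.
Proof.
  intros H. unfold CGamma. rewrite <- (C_lim_seq_RtoC _ _ H).
  assert (E : forall n, RtoC (INR (fact n)) * Cexp (s * RtoC (ln (INR n))) / rising s (S n)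
                        = RtoC (gauss_seq s n)).
  { intros n. unfold gauss_seq.
    rewrite <- RtoC_mult, Cexp_RtoC, rising_RtoC, RtoC_Rdiv, RtoC_mult.
    reflexivity. }
  unfold C_lim_seq. f_equal; f_equal; apply Lim_seq_ext; intros n; rewrite E; reflexivity.
Qed.

Lemma rrising_shift (s : R) (n : nat) : rrising s (S n) = (s * rrising (s + 1) n)%R.
Proof.
  induction n as [|n IH]; [simpl; ring|].
  change (rrising s (S (S n))) with (rrising s (S n) * (s + INR (S n)))%R.
  rewrite IH, S_INR. simpl. ring.
Qed.

Lemma is_lim_seq_ratio (s : R) :
  is_lim_seq (fun n => (INR n / (s + 1 + INR n))%R) 1%R.
Proof.
  assert (H : is_lim_seq (fun n => (INR n + (s + 1))%R) p_infty).
  { apply is_lim_seq_plus with p_infty (s + 1)%R;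
      [apply is_lim_seq_INR|apply is_lim_seq_const|reflexivity]. }
  apply is_lim_seq_ext_loc with (fun n => (1 - (s + 1) * / (INR n + (s + 1)))%R).
  - assert (H' := H (fun y => (0 < y)%R)).
    destruct H' as [n0 Hn0]; [exists 0%R; intros y Hy; exact Hy|].
    exists n0; intros n Hn; specialize (Hn0 n Hn). field. lra.
  - replace (Finite 1%R) with (Finite (1 - (s + 1) * 0)%R) by (f_equal; ring).
    apply is_lim_seq_minus'; [apply is_lim_seq_const|].
    apply is_lim_seq_mult'; [apply is_lim_seq_const|].
    replace (Finite 0%R) with (Rbar_inv p_infty) by reflexivity.
    apply is_lim_seq_inv; [exact H|discriminate].
Qed.

(** Passing from s to s + 1 trades the factor s of the rising product for
    s + 1 + n and multiplies the power of n by n.  The functional equation of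
    Gamma follows, since n / (s + 1 + n) --> 1. *)
Lemma gauss_seq_shift (s : R) (n : nat) :
  (0 < n)%nat -> s <> 0%R ->
  gauss_seq (s + 1) n = (gauss_seq s n * s * (INR n / (s + 1 + INR n)))%R.
Proof.
  intros Hn Hs. unfold gauss_seq.
  rewrite (rrising_shift s n). simpl rrising.
  rewrite Rmult_plus_distr_r, exp_plus, Rmult_1_l, exp_ln by (apply lt_0_INR, Hn).
  unfold Rdiv. rewrite !Rinv_mult.
  replace (INR (fact n) * exp (s * ln (INR n)) * (/ s * / rrising (s + 1) n) * s)%R
    with (INR (fact n) * exp (s * ln (INR n)) * / rrising (s + 1) n * (/ s * s))%R by ring.
  rewrite Rinv_l by exact Hs. ring.
Qed.

Lemma gauss_seq_succ (s l : R) :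
  s <> 0%R -> is_lim_seq (gauss_seq s) l -> is_lim_seq (gauss_seq (s + 1)) (l * s)%R.
Proof.
  intros Hs H.
  apply is_lim_seq_ext_loc
    with (fun n => (gauss_seq s n * s * (INR n / (s + 1 + INR n)))%R).
  - exists 1%nat; intros n Hn; symmetry; apply gauss_seq_shift; [lia|exact Hs].
  - rewrite <- (Rmult_1_r (l * s)).
    apply is_lim_seq_mult'; [|apply is_lim_seq_ratio].
    apply is_lim_seq_mult'; [exact H|apply is_lim_seq_const].
Qed.

Lemma gauss_seq_pred (s l : R) :
  s <> 0%R -> is_lim_seq (gauss_seq (s + 1)) l -> is_lim_seq (gauss_seq s) (l / s)%R.
Proof.
  intros Hs H.
  apply is_lim_seq_ext_loc
    with (fun n => (gauss_seq (s + 1) n * / s * / (INR n / (s + 1 + INR n)))%R).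
  - assert (Hr := is_lim_seq_ratio s (fun y => (0 < y)%R)).
    destruct Hr as [n0 Hn0].
    { exists (mkposreal 1 Rlt_0_1); intros y Hy.
      unfold ball in Hy; simpl in Hy.
      unfold AbsRing_ball, abs, minus, plus, opp in Hy; simpl in Hy.
      apply Rabs_lt_between in Hy; lra. }
    exists (S n0); intros n Hn. specialize (Hn0 n ltac:(lia)).
    rewrite gauss_seq_shift by (try lia; exact Hs).
    set (q := (INR n / (s + 1 + INR n))%R) in *. field. split; [lra|exact Hs].
  - replace (Finite (l / s)) with (Finite (l * / s * / 1)%R) by (f_equal; field; exact Hs).
    apply is_lim_seq_mult'.
    + apply is_lim_seq_mult'; [exact H|apply is_lim_seq_const].
    + apply (is_lim_seq_inv _ (Finite 1%R)); [apply is_lim_seq_ratio|].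
      intros E; injection E; lra.
Qed.

Lemma is_series_zero : is_series (fun _ => 0%R) 0%R.
Proof.
  change (is_lim_seq (sum_n (fun _ => 0%R)) 0%R).
  apply (is_lim_seq_ext (fun _ => 0%R)); [|apply is_lim_seq_const].
  intros n; rewrite sum_n_const; ring.
Qed.

(** * The reciprocal Gamma function near 1 *)

(** The logarithm of the factor of index k + 1 in Euler's product
    1/Gamma(1+x) = prod_j (1 + x/j) (1 + 1/j)^(-x). *)
Definition euler_log (k : nat) (x : R) : R :=
  (ln (1 + x / INR (S k)) - x * ln (1 + 1 / INR (S k)))%R.

(** The derivative of [euler_log k] at 0; these terms add up to Euler's constant. *)
Definition euler_gamma_term (k : nat) : R :=
  (1 / INR (S k) - ln (1 + 1 / INR (S k)))%R.

(** Both inequalities are 1 + v <= exp v, taken at v = u and at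
    v = 1/(1+u) - 1. *)
Lemma ln_1p_bound (u : R) :
  (- (1 / 2) <= u)%R -> (0 <= u - ln (1 + u) <= 2 * (u * u))%R.
Proof.
  intros Hu; split.
  - assert (ln (1 + u) <= ln (exp u))%R.
    { apply ln_le; [lra|apply exp_ineq1_le]. }
    rewrite ln_exp in H; lra.
  - assert (H : (ln (/ (1 + u)) <= ln (exp (/ (1 + u) - 1)))%R).
    { apply ln_le; [apply Rinv_0_lt_compat; lra|].
      pose proof (exp_ineq1_le (/ (1 + u) - 1)). lra. }
    rewrite ln_exp, ln_Rinv in H by lra.
    assert (u + / (1 + u) - 1 <= 2 * (u * u))%R; [|lra].
    replace (u + / (1 + u) - 1)%R with (u * u * / (1 + u))%R by (field; lra).
    rewrite (Rmult_comm 2). apply Rmult_le_compat_l; [nra|].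
    replace 2%R with (/ (1 / 2))%R by field. apply Rinv_le_contravar; lra.
Qed.

(** Comparison with the telescoping series of 4 (1/(k+1) - 1/(k+2)). *)
Lemma ex_series_inv_square : ex_series (fun k => (2 * (/ INR (S k) * / INR (S k)))%R).
Proof.
  apply (@ex_series_le R_AbsRing R_CompleteNormedModule _
      (fun k => (4 * (/ INR (S k) - / INR (S (S k))))%R)).
  - intros k.
    change (Rabs (2 * (/ INR (S k) * / INR (S k)))
              <= 4 * (/ INR (S k) - / INR (S (S k))))%R.
    pose proof (lt_0_INR (S k) ltac:(lia)) as Hk.
    rewrite (S_INR (S k)). set (c := INR (S k)) in *.
    assert (1 <= c)%R by (unfold c; apply (le_INR 1); lia).
    pose proof (Rinv_0_lt_compat c Hk).
    rewrite Rabs_pos_eq by nra.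
    replace (/ c - / (c + 1))%R with (/ c * / (c + 1))%R by (field; lra).
    replace (2 * (/ c * / c))%R with (/ c * (2 * / c))%R by ring.
    replace (4 * (/ c * / (c + 1)))%R with (/ c * (4 * / (c + 1)))%R by ring.
    apply Rmult_le_compat_l; [lra|].
    apply Rmult_le_reg_r with (c * (c + 1))%R; [nra|].
    replace (2 * / c * (c * (c + 1)))%R with (2 * (c + 1))%R by (field; lra).
    replace (4 * / (c + 1) * (c * (c + 1)))%R with (4 * c)%R by (field; lra). lra.
  - apply (ex_series_scal_l (K := R_AbsRing) 4 (fun k => (/ INR (S k) - / INR (S (S k)))%R)).
    exists 1%R.
    change (is_lim_seq (sum_n (fun k => (/ INR (S k) - / INR (S (S k)))%R)) 1%R).
    apply (is_lim_seq_ext (fun n => (1 - / INR (S (S n)))%R)).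
    + intros n; induction n as [|n IH].
      * rewrite sum_O. simpl. field.
      * rewrite sum_Sn, <- IH. unfold plus; simpl plus. simpl. ring.
    + replace (Finite 1%R) with (Finite (1 - 0)%R) by (f_equal; ring).
      apply is_lim_seq_minus'; [apply is_lim_seq_const|].
      replace (Finite 0%R) with (Rbar_inv p_infty) by reflexivity.
      apply is_lim_seq_inv; [|discriminate].
      pose proof (proj1 (is_lim_seq_incr_n INR 2 p_infty) is_lim_seq_INR) as H2.
      apply is_lim_seq_ext with (2 := H2). intros n; f_equal; lia.
Qed.

Lemma euler_log_remainder (k : nat) (x : R) :
  (Rabs x <= 1 / 2)%R ->
  (Rabs (euler_log k x - x * euler_gamma_term k)
     <= 2 * (/ INR (S k) * / INR (S k)) * (Rabs x * Rabs x))%R.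
Proof.
  intros Hx. unfold euler_log, euler_gamma_term.
  pose proof (lt_0_INR (S k) ltac:(lia)) as Hk.
  assert (1 <= INR (S k))%R by (apply (le_INR 1); lia).
  set (c := INR (S k)) in *. pose proof (Rinv_0_lt_compat c Hk) as Hi.
  assert (Hi1 : (/ c <= 1)%R) by (rewrite <- Rinv_1; apply Rinv_le_contravar; lra).
  apply Rabs_le_between in Hx.
  assert (Hu : (- (1 / 2) <= x / c)%R) by (unfold Rdiv; nra).
  destruct (ln_1p_bound _ Hu) as [B1 B2].
  replace (ln (1 + x / c) - x * ln (1 + 1 / c) - x * (1 / c - ln (1 + 1 / c)))%R
    with (- (x / c - ln (1 + x / c)))%R by (field; lra).
  rewrite Rabs_Ropp, Rabs_pos_eq by exact B1.
  eapply Rle_trans; [exact B2|]. rewrite <- Rabs_mult, (Rabs_pos_eq (x * x)) by nra.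
  apply Req_le; field; lra.
Qed.

Lemma euler_gamma_term_bound (k : nat) :
  (Rabs (euler_gamma_term k) <= 2 * (/ INR (S k) * / INR (S k)))%R.
Proof.
  unfold euler_gamma_term.
  pose proof (lt_0_INR (S k) ltac:(lia)) as Hk. set (c := INR (S k)) in *.
  pose proof (Rinv_0_lt_compat c Hk) as Hi.
  destruct (ln_1p_bound (1 / c)) as [B1 B2]; [unfold Rdiv; lra|].
  rewrite Rabs_pos_eq by exact B1. eapply Rle_trans; [exact B2|].
  apply Req_le; field; lra.
Qed.

Definition euler_gamma : R := Series euler_gamma_term.

Lemma euler_gamma_correct : is_series euler_gamma_term euler_gamma.
Proof.
  apply Series_correct.
  apply (@ex_series_le R_AbsRing R_CompleteNormedModule _
      (fun k => (2 * (/ INR (S k) * / INR (S k)))%R));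
    [apply euler_gamma_term_bound|apply ex_series_inv_square].
Qed.

Definition log_rGamma1p (x : R) : R := Series (fun k => euler_log k x).

Lemma log_rGamma1p_correct (x : R) :
  (Rabs x <= 1 / 2)%R -> is_series (fun k => euler_log k x) (log_rGamma1p x).
Proof.
  intros Hx. apply Series_correct.
  apply (@ex_series_le R_AbsRing R_CompleteNormedModule _
      (fun k => (2 * (/ INR (S k) * / INR (S k)))%R)); [|apply ex_series_inv_square].
  intros k. change (Rabs (euler_log k x) <= 2 * (/ INR (S k) * / INR (S k)))%R.
  pose proof (euler_log_remainder k x Hx) as H1.
  pose proof (euler_gamma_term_bound k) as H2. pose proof (Rabs_pos x).
  replace (euler_log k x)
    with ((euler_log k x - x * euler_gamma_term k) + x * euler_gamma_term k)%R by ring.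
  eapply Rle_trans; [apply Rabs_triang|]. rewrite Rabs_mult.
  set (m := (2 * (/ INR (S k) * / INR (S k)))%R) in *.
  assert (0 <= m)%R by (eapply Rle_trans; [apply Rabs_pos|exact H2]).
  assert (m * (Rabs x * Rabs x) <= m * (1 / 2 * 1))%R
    by (apply Rmult_le_compat_l; [assumption|apply Rmult_le_compat; lra]).
  assert (Rabs x * Rabs (euler_gamma_term k) <= 1 / 2 * m)%R
    by (apply Rmult_le_compat; try assumption; apply Rabs_pos).
  lra.
Qed.

(** This is 1/Gamma(1+x) for |x| <= 1/2; by its functional equation it determines
    the coefficients of all the Bessel functions of order near an integer. *)
Definition rGamma1p (x : R) : R := exp (log_rGamma1p x).

(** Why 1/Gamma is differentiable at 1: in Euler's product the logarithm of the
    j-th factor differs from its linear part by O(x^2 / j^2), so the sum of the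
    logarithms is differentiable term by term. *)
Lemma expands_rGamma1p :
  expands Rabs (fun x => RtoC (rGamma1p x)) 1 (fun x => RtoC euler_gamma * RtoC x).
Proof.
  assert (H : expands Rabs (fun x => RtoC (log_rGamma1p x)) 0
                (fun x => RtoC euler_gamma * RtoC x)).
  { apply expands_series with
      (f := fun k x => RtoC (euler_log k x)) (a := fun _ => RtoC 0)
      (L := fun k x => RtoC (x * euler_gamma_term k))
      (M := fun k => (2 * (/ INR (S k) * / INR (S k)))%R) (r := (1 / 2)%R).
    - apply Rabs_pos.
    - lra.
    - intros x Hx. apply is_series_RtoC, log_rGamma1p_correct; lra.
    - apply (is_series_RtoC (fun _ => 0%R) 0%R).
      apply is_series_zero.
    - intros x. rewrite <- RtoC_mult, Rmult_comm.
      apply (is_series_RtoC (fun k => (x * euler_gamma_term k)%R)).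
      apply (is_series_scal_l (K := R_AbsRing) x euler_gamma_term euler_gamma),
        euler_gamma_correct.
    - exists (Rabs euler_gamma); intros x; rewrite Cmod_mult, !Cmod_R; lra.
    - apply ex_series_inv_square.
    - intros k x Hx. rewrite <- !RtoC_minus, Cmod_R, Rminus_0_r.
      apply euler_log_remainder; lra. }
  eapply expands_ext.
  - apply (expands_comp Rabs Rabs_pos Cexp (Cexp 0) 0); [apply expands_Cexp|exact H].
  - intros x; simpl. apply Cexp_RtoC.
  - rewrite Cexp_RtoC, exp_0; reflexivity.
  - intros x; simpl. rewrite Cexp_RtoC, exp_0. ring.
Qed.

Lemma rrising_neq_0 (x : R) (n : nat) : (Rabs x <= 1 / 2)%R -> rrising (1 + x) n <> 0%R.
Proof.
  intros Hx; apply Rabs_le_between in Hx.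
  induction n as [|n IH]; simpl; [lra|].
  apply Rmult_integral_contrapositive_currified; [exact IH|].
  pose proof (pos_INR n); lra.
Qed.

(** The powers (1 + 1/j)^x telescope to (n + 2)^x. *)
Lemma euler_product (x : R) (n : nat) :
  (Rabs x <= 1 / 2)%R ->
  (exp (sum_n (fun k => euler_log k x) n) * INR (fact (S n)) * exp (x * ln (INR (S (S n))))
   = rrising (1 + x) (S n))%R.
Proof.
  intros Hx; assert (Hx' := Hx); apply Rabs_le_between in Hx'.
  assert (Hstep : forall k, (exp (euler_log k x) * INR (S k) *
      exp (x * ln (INR (S (S k)))) = (1 + x + INR k) * exp (x * ln (INR (S k))))%R).
  { intros k. unfold euler_log.
    pose proof (lt_0_INR (S k) ltac:(lia)) as Hk. 
    assert (1 <= INR (S k))%R by (apply (le_INR 1); lia).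
    replace (1 + x + INR k)%R with (INR (S k) + x)%R by (rewrite S_INR; ring).
    rewrite (S_INR (S k)). set (c := INR (S k)) in *.
    assert (Hc : (0 < 1 + x / c)%R).
    { replace (1 + x / c)%R with ((c + x) * / c)%R by (field; lra).
      apply Rmult_lt_0_compat; [lra|apply Rinv_0_lt_compat; lra]. }
    assert (E : (ln (c + 1) = ln c + ln (1 + 1 / c))%R).
    { rewrite <- ln_mult.
      - f_equal; field; lra.
      - lra.
      - pose proof (Rinv_0_lt_compat c Hk); unfold Rdiv; lra. }
    rewrite E. unfold Rminus. rewrite exp_plus, exp_ln by exact Hc.
    rewrite Rmult_plus_distr_l, exp_plus, exp_Ropp.
    pose proof (exp_pos (x * ln (1 + 1 / c))). field. split; lra. }
  induction n as [|n IH].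
  - rewrite sum_O. specialize (Hstep O). simpl fact. simpl rrising.
    replace (INR 1) with 1%R in * by reflexivity. simpl INR in Hstep |- *.
    rewrite Rmult_1_l. rewrite ln_1, Rmult_0_r, exp_0 in Hstep. lra.
  - rewrite sum_Sn. unfold plus; simpl plus. rewrite exp_plus.
    change (rrising (1 + x) (S (S n))) with (rrising (1 + x) (S n) * (1 + x + INR (S n)))%R.
    rewrite <- IH, (fact_simpl (S n)), mult_INR.
    specialize (Hstep (S n)).
    set (F := INR (fact (S n))) in *. set (E := exp (sum_n _ n)) in *.
    replace (E * exp (euler_log (S n) x) * (INR (S (S n)) * F) *
             exp (x * ln (INR (S (S (S n))))))%R
      with (E * F * (exp (euler_log (S n) x) * INR (S (S n)) *
             exp (x * ln (INR (S (S (S n)))))))%R by ring.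
    rewrite Hstep. ring.
Qed.

Lemma is_lim_seq_ln_ratio :
  is_lim_seq (fun n => (ln (INR n) - ln (INR (S (S n))))%R) 0%R.
Proof.
  apply is_lim_seq_ext_loc with (fun n => ln (INR n / (1 + 1 + INR n))).
  - exists 1%nat; intros n Hn. rewrite !S_INR.
    pose proof (lt_0_INR n ltac:(lia)).
    unfold Rdiv. rewrite ln_mult by (try apply Rinv_0_lt_compat; lra).
    rewrite ln_Rinv by lra. replace (1 + 1 + INR n)%R with (INR n + 1 + 1)%R by ring. ring.
  - replace (Finite 0%R) with (Finite (ln 1)) by (rewrite ln_1; reflexivity).
    apply is_lim_seq_continuous; [|apply is_lim_seq_ratio].
    apply derivable_continuous_pt. exists (/ 1)%R. apply derivable_pt_lim_ln. lra.
Qed.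

(** Gauss' and Euler's products differ by the factor
    n/(n+1) exp (x (ln n - ln (n+2))), which tends to 1. *)
Lemma gauss_seq_1p (x : R) :
  (Rabs x <= 1 / 2)%R -> is_lim_seq (gauss_seq (1 + x)) (/ rGamma1p x)%R.
Proof.
  intros Hx.
  apply is_lim_seq_ext_loc with (fun n =>
    (/ exp (sum_n (fun k => euler_log k x) n) * (INR n / (0 + 1 + INR n)) *
     exp (x * (ln (INR n) - ln (INR (S (S n))))))%R).
  - exists 1%nat; intros n Hn. unfold gauss_seq.
    rewrite <- (euler_product x n Hx), fact_simpl, mult_INR.
    pose proof (lt_0_INR n ltac:(lia)).
    replace (0 + 1 + INR n)%R with (INR (S n)) by (rewrite S_INR; ring).
    rewrite Rmult_minus_distr_l. unfold Rminus. rewrite exp_plus, exp_Ropp.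
    rewrite Rmult_plus_distr_r, Rmult_1_l, exp_plus, exp_ln by assumption.
    pose proof (exp_pos (sum_n (fun k => euler_log k x) n)).
    pose proof (exp_pos (x * ln (INR (S (S n))))).
    pose proof (INR_fact_neq_0 n). pose proof (not_0_INR (S n) ltac:(lia)).
    field. repeat split; try assumption; lra.
  - replace (Finite (/ rGamma1p x))
      with (Finite (/ exp (log_rGamma1p x) * 1 * exp (x * 0))%R)
      by (unfold rGamma1p; rewrite Rmult_0_r, exp_0; f_equal; ring).
    apply is_lim_seq_mult'; [apply is_lim_seq_mult'|].
    + apply (is_lim_seq_inv _ (Finite (exp (log_rGamma1p x)))).
      * apply is_lim_seq_continuous; [apply derivable_continuous_pt, derivable_pt_exp|].
        apply log_rGamma1p_correct, Hx.
      * intros E; injection E; pose proof (exp_pos (log_rGamma1p x)); lra.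
    + apply is_lim_seq_ratio.
    + apply is_lim_seq_continuous; [apply derivable_continuous_pt, derivable_pt_exp|].
      apply is_lim_seq_mult'; [apply is_lim_seq_const|apply is_lim_seq_ln_ratio].
Qed.

Lemma gauss_seq_Sk (x : R) (k : nat) :
  (Rabs x <= 1 / 2)%R ->
  is_lim_seq (gauss_seq (x + (INR k + 1))) (rrising (1 + x) k / rGamma1p x)%R.
Proof.
  intros Hx. assert (Hx' := Hx); apply Rabs_le_between in Hx'.
  induction k as [|k IH].
  - simpl. replace (x + (0 + 1))%R with (1 + x)%R by ring.
    unfold Rdiv; rewrite Rmult_1_l. apply gauss_seq_1p, Hx.
  - rewrite S_INR. replace (x + (INR k + 1 + 1))%R with (x + (INR k + 1) + 1)%R by ring.
    replace (rrising (1 + x) (S k) / rGamma1p x)%R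
      with (rrising (1 + x) k / rGamma1p x * (x + (INR k + 1)))%R
      by (simpl; unfold Rdiv; ring).
    apply gauss_seq_succ; [pose proof (pos_INR k); lra|exact IH].
Qed.

Lemma CGamma_shifted (x : R) (k : nat) :
  (Rabs x <= 1 / 2)%R ->
  CGamma (RtoC (x + (INR k + 1))%R) = RtoC (rrising (1 + x) k / rGamma1p x).
Proof. intros Hx; apply CGamma_RtoC, gauss_seq_Sk, Hx. Qed.

(** The functional equation read downwards, across the pole at 0. *)
Lemma CGamma_near_0 (x : R) :
  (Rabs x <= 1 / 2)%R -> x <> 0%R ->
  CGamma (RtoC x) = RtoC (/ rGamma1p x / x).
Proof.
  intros Hx H0. apply CGamma_RtoC, gauss_seq_pred; [exact H0|].
  rewrite Rplus_comm. apply gauss_seq_1p, Hx.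
Qed.

Lemma rGamma1p_0 : rGamma1p 0 = 1%R.
Proof.
  unfold rGamma1p, log_rGamma1p. rewrite <- exp_0. f_equal.
  transitivity (Series (fun _ => 0%R)); [|apply (is_series_unique _ _ is_series_zero)].
  apply Series_ext; intros k. unfold euler_log, Rdiv. rewrite !Rmult_0_l, Rplus_0_r, ln_1. ring.
Qed.

Lemma rrising_1 (k : nat) : rrising (1 + 0) k = INR (fact k).
Proof.
  induction k as [|k IH]; [reflexivity|].
  rewrite fact_simpl, mult_INR, <- IH, S_INR. simpl. ring.
Qed.

Lemma CGamma_fact (k : nat) : CGamma (RtoC (INR k + 1)%R) = RtoC (INR (fact k)).
Proof.
  pose proof (CGamma_shifted 0 k ltac:(rewrite Rabs_R0; lra)) as H.
  rewrite Rplus_0_l in H. rewrite H, rGamma1p_0, rrising_1, Rdiv_1_r. reflexivity.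
Qed.

(** * Derivatives of the Bessel series with respect to the order *)

Fixpoint harmonic (n : nat) : R :=
  match n with
  | O => 0%R
  | S m => (harmonic m + / INR (S m))%R
  end.

Lemma harmonic_bound (n : nat) : (0 <= harmonic n <= INR n)%R.
Proof.
  induction n as [|n IH]; [simpl; lra|].
  change (harmonic (S n)) with (harmonic n + / INR (S n))%R.
  assert (1 <= INR (S n))%R by (apply (le_INR 1); lia).
  pose proof (Rinv_0_lt_compat (INR (S n)) ltac:(lra)).
  assert (/ INR (S n) <= 1)%R by (rewrite <- Rinv_1; apply Rinv_le_contravar; lra).
  rewrite S_INR in *. lra.
Qed.

Lemma inv_fact_bound (n : nat) : (0 < / INR (fact n) <= 1)%R.
Proof.
  assert (1 <= INR (fact n))%R by (apply (le_INR 1), lt_O_fact).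
  split; [apply Rinv_0_lt_compat; lra|].
  rewrite <- Rinv_1; apply Rinv_le_contravar; lra.
Qed.

Lemma inv_rrising_bound (x : R) (n : nat) :
  (Rabs x <= 1 / 2)%R -> (0 < / rrising (1 + x) n <= 2 ^ n)%R.
Proof.
  intros Hx; apply Rabs_le_between in Hx.
  assert (H : (/ 2 ^ n <= rrising (1 + x) n)%R).
  { induction n as [|n IH]; [simpl; lra|].
    simpl. pose proof (pos_INR n).
    assert (0 < / 2 ^ n)%R by (apply Rinv_0_lt_compat, pow_lt; lra).
    rewrite Rinv_mult. rewrite Rmult_comm. apply Rmult_le_compat; lra. }
  assert (0 < / 2 ^ n)%R by (apply Rinv_0_lt_compat, pow_lt; lra).
  split; [apply Rinv_0_lt_compat; lra|].
  rewrite <- (Rinv_inv (2 ^ n)). apply Rinv_le_contravar; assumption.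
Qed.

(** The derivative of 1/((1+x)...(n+x)) at 0 is -H_n/n!.  With c = n + 1, the
    remainders r_n of order two satisfy
    (c + x) r_(n+1) = r_n + x^2 (H_n/c + 1/c^2) / n!, where 1/(c + x) <= 2;
    so they at most double at each step, up to a bounded multiple of x^2. *)
Lemma inv_rrising_expansion (x : R) (n : nat) :
  (Rabs x <= 1 / 2)%R ->
  (Rabs (/ rrising (1 + x) n - / INR (fact n) - - (harmonic n / INR (fact n)) * x)
     <= 4 * 2 ^ n * (Rabs x * Rabs x))%R.
Proof.
  intros Hx. rewrite <- Rabs_mult, (Rabs_pos_eq (x * x)) by nra.
  assert (Hx' := Hx); apply Rabs_le_between in Hx'.
  (* The sharper constant 2^n - 1 is what the induction reproduces. *)
  cut (Rabs (/ rrising (1 + x) n - / INR (fact n) - - (harmonic n / INR (fact n)) * x)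
     <= 4 * (2 ^ n - 1) * (x * x))%R.
  { intros H; eapply Rle_trans; [exact H|]. apply Rmult_le_compat_r; nra. }
  induction n as [|n IH].
  - simpl. unfold Rdiv. rewrite Rinv_1.
    replace (1 - 1 - - (0 * 1) * x)%R with 0%R by ring. rewrite Rabs_R0. lra.
  - set (r := (/ rrising (1 + x) n - / INR (fact n) -
               - (harmonic n / INR (fact n)) * x)%R) in *.
    set (c := INR (S n)).
    assert (Hc : (1 <= c)%R) by (apply (le_INR 1); lia).
    assert (E : (/ rrising (1 + x) (S n) - / INR (fact (S n)) -
                 - (harmonic (S n) / INR (fact (S n))) * x
       = / (c + x) * (r + / INR (fact n) * (harmonic n * / c + / c * / c) * (x * x)))%R).
    { unfold r. rewrite fact_simpl, mult_INR.
      change (harmonic (S n)) with (harmonic n + / INR (S n))%R. fold c.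
      change (rrising (1 + x) (S n)) with (rrising (1 + x) n * (1 + x + INR n))%R.
      replace (1 + x + INR n)%R with (c + x)%R by (unfold c; rewrite S_INR; ring).
      pose proof (INR_fact_neq_0 n). pose proof (rrising_neq_0 x n Hx).
      field. repeat split; try assumption; lra. }
    rewrite E, Rabs_mult.
    assert (Hinv : (0 < / c <= 1)%R).
    { split; [apply Rinv_0_lt_compat; lra|].
      rewrite <- Rinv_1; apply Rinv_le_contravar; lra. }
    assert (Hcx : (Rabs (/ (c + x)) <= 2)%R).
    { rewrite Rabs_pos_eq by (apply Rlt_le, Rinv_0_lt_compat; lra).
      replace 2%R with (/ (1 / 2))%R by field. apply Rinv_le_contravar; lra. }
    pose proof (inv_fact_bound n) as Hf. pose proof (harmonic_bound n) as Hh.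
    assert (Hhc : (0 <= harmonic n * / c <= 1)%R).
    { split; [apply Rmult_le_pos; lra|].
      apply Rle_trans with (c * / c)%R; [|rewrite Rinv_r; lra].
      apply Rmult_le_compat_r; [lra|]. unfold c; rewrite S_INR; lra. }
    assert (Hq : (0 <= / INR (fact n) * (harmonic n * / c + / c * / c) <= 2)%R).
    { assert (0 <= / c * / c <= 1)%R by nra. split; [apply Rmult_le_pos; lra|].
      apply Rle_trans with (1 * 2)%R; [apply Rmult_le_compat; lra|lra]. }
    set (q := (/ INR (fact n) * (harmonic n * / c + / c * / c))%R) in *.
    assert (Hxx : (0 <= x * x)%R) by nra.
    apply Rle_trans with (2 * (4 * (2 ^ n - 1) * (x * x) + 2 * (x * x)))%R.
    + apply Rmult_le_compat; auto using Rabs_pos.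
      eapply Rle_trans; [apply Rabs_triang|]. apply Rplus_le_compat; [exact IH|].
      rewrite Rabs_pos_eq by (apply Rmult_le_pos; lra).
      apply Rmult_le_compat_r; lra.
    + simpl. nra.
Qed.

Lemma exp_bounded_mult (w v : nat -> R) (B K : R) :
  (forall k, (Rabs (w k) <= / INR (fact k))%R) ->
  (0 <= B)%R -> (0 <= K)%R -> (forall k, (Rabs (v k) <= B * K ^ k)%R) ->
  exp_bounded (fun k => RtoC (w k * v k)).
Proof.
  intros Hw HB HK Hv. exists B, K; split; [exact HB|]; split; [exact HK|].
  intros k. rewrite Cmod_R, Rabs_mult.
  replace (B * (K ^ k / INR (fact k)))%R with (/ INR (fact k) * (B * K ^ k))%R
    by (unfold Rdiv; ring).
  apply Rmult_le_compat; auto using Rabs_pos.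
Qed.

(** With coefficients w_k = +-1/k! or +-1/(k+1)!, the sums [gamma_sum w s x] at
    t = e^z are, up to elementary factors, the Bessel functions of 2 e^(z/2)
    whose order differs from an integer by x.  The sequences [fact_coef w s] and
    [harmonic_coef w s] are the coefficients of the value and of the derivative
    in x at x = 0. *)
Definition gamma_sum (w : nat -> R) (s : nat) (x : R) : C -> C :=
  power_sum (fun k => RtoC (w k * / rrising (1 + x) (k + s))).
Definition fact_coef (w : nat -> R) (s : nat) (k : nat) : C :=
  RtoC (w k * / INR (fact (k + s))).
Definition harmonic_coef (w : nat -> R) (s : nat) (k : nat) : C :=
  RtoC (w k * - (harmonic (k + s) / INR (fact (k + s)))).

Lemma exp_bounded_gamma_sum (w : nat -> R) (s : nat) (x : R) :
  (forall k, (Rabs (w k) <= / INR (fact k))%R) -> (Rabs x <= 1 / 2)%R ->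
  exp_bounded (fun k => RtoC (w k * / rrising (1 + x) (k + s))).
Proof.
  intros Hw Hx. apply exp_bounded_mult with (2 ^ s)%R 2%R; try lra; [exact Hw|apply pow_le; lra|].
  intros k. destruct (inv_rrising_bound x (k + s) Hx).
  rewrite Rabs_pos_eq by lra. rewrite <- pow_add, (Nat.add_comm s). assumption.
Qed.

Lemma exp_bounded_fact_coef (w : nat -> R) (s : nat) :
  (forall k, (Rabs (w k) <= / INR (fact k))%R) -> exp_bounded (fact_coef w s).
Proof.
  intros Hw. apply exp_bounded_mult with 1%R 1%R; try lra; [exact Hw|].
  intros k. destruct (inv_fact_bound (k + s)).
  rewrite Rabs_pos_eq by lra. rewrite pow1; lra.
Qed.

Lemma exp_bounded_harmonic_coef (w : nat -> R) (s : nat) :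
  (forall k, (Rabs (w k) <= / INR (fact k))%R) -> exp_bounded (harmonic_coef w s).
Proof.
  intros Hw. apply exp_bounded_mult with (2 ^ s)%R 2%R; try lra; [exact Hw|apply pow_le; lra|].
  intros k. destruct (inv_fact_bound (k + s)). destruct (harmonic_bound (k + s)).
  rewrite Rabs_Ropp, Rabs_pos_eq by (unfold Rdiv; apply Rmult_le_pos; lra).
  rewrite <- pow_add, (Nat.add_comm s).
  eapply Rle_trans; [|apply INR_le_pow2]. unfold Rdiv.
  rewrite <- (Rmult_1_r (INR (k + s))). apply Rmult_le_compat; lra.
Qed.

Lemma expands_gamma_sum (w : nat -> R) (s : nat) (t : C) :
  (forall k, (Rabs (w k) <= / INR (fact k))%R) ->
  expands Rabs (fun x => gamma_sum w s x t) (power_sum (fact_coef w s) t)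
    (fun x => power_sum (harmonic_coef w s) t * RtoC x).
Proof.
  intros Hw.
  apply expands_series with
    (f := fun k x => RtoC (w k * / rrising (1 + x) (k + s)) * t ^ k)
    (a := fun k => fact_coef w s k * t ^ k)
    (L := fun k x => harmonic_coef w s k * t ^ k * RtoC x)
    (M := fun k => (4 * 2 ^ s * ((2 * Cmod t) ^ k / INR (fact k)))%R) (r := (1 / 2)%R).
  - apply Rabs_pos.
  - lra.
  - intros x Hx. apply power_sum_correct, exp_bounded_gamma_sum; [exact Hw|lra].
  - apply power_sum_correct, exp_bounded_fact_coef, Hw.
  - intros x. apply is_series_C_ext with (fun k => RtoC x * (harmonic_coef w s k * t ^ k));
      [intros k; ring|].
    rewrite Cmult_comm. apply is_series_C_scal.
    apply power_sum_correct, exp_bounded_harmonic_coef, Hw.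
  - eexists; intros x; rewrite Cmod_mult, Cmod_R; apply Rle_refl.
  - apply ex_series_pow_fact.
  - intros k x Hx. unfold fact_coef, harmonic_coef.
    set (n := (k + s)%nat).
    replace (RtoC (w k * / rrising (1 + x) n) * t ^ k -
             RtoC (w k * / INR (fact n)) * t ^ k -
             RtoC (w k * - (harmonic n / INR (fact n))) * t ^ k * x)
      with (RtoC (w k * (/ rrising (1 + x) n - / INR (fact n) -
                         - (harmonic n / INR (fact n)) * x)) * t ^ k)
      by (rewrite !RtoC_mult, !RtoC_minus, !RtoC_mult; ring).
    rewrite Cmod_mult, Cmod_pow, Cmod_R, Rabs_mult.
    pose proof (inv_rrising_expansion x n ltac:(lra)) as H.
    set (e := Rabs (/ rrising (1 + x) n - _ - _)) in *.
    replace (4 * 2 ^ s * ((2 * Cmod t) ^ k / INR (fact k)) * (Rabs x * Rabs x))%R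
      with (/ INR (fact k) * (4 * 2 ^ n * (Rabs x * Rabs x)) * Cmod t ^ k)%R
      by (unfold n; rewrite pow_add, Rpow_mult_distr; unfold Rdiv; ring).
    apply Rmult_le_compat_r; [apply pow_le, Cmod_ge_0|].
    apply Rmult_le_compat; auto; unfold e; apply Rabs_pos.
Qed.

(** * Bessel functions of order close to -1, 0 and 1 *)

Definition alt_inv_fact (k : nat) : R := ((-1) ^ k / INR (fact k))%R.
Definition alt_inv_fact_succ (k : nat) : R := ((-1) ^ k / INR (fact (S k)))%R.

Lemma Rabs_pow_m1 (k : nat) : Rabs ((-1) ^ k) = 1%R.
Proof. rewrite <- RPow_abs, Rabs_m1, pow1; reflexivity. Qed.

Lemma alt_inv_fact_bound (k : nat) : (Rabs (alt_inv_fact k) <= / INR (fact k))%R.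
Proof.
  unfold alt_inv_fact, Rdiv. rewrite Rabs_mult, Rabs_pow_m1.
  rewrite Rabs_pos_eq by (apply Rlt_le, inv_fact_bound). lra.
Qed.

Lemma alt_inv_fact_succ_bound (k : nat) : (Rabs (alt_inv_fact_succ k) <= / INR (fact k))%R.
Proof.
  unfold alt_inv_fact_succ, Rdiv. rewrite Rabs_mult, Rabs_pow_m1.
  rewrite Rabs_pos_eq by (apply Rlt_le, inv_fact_bound).
  rewrite Rmult_1_l. apply Rinv_le_contravar; [apply INR_fact_lt_0|].
  apply le_INR. rewrite fact_simpl. nia.
Qed.

Lemma Cexp_0 : Cexp 0 = 1.
Proof. rewrite (Cexp_RtoC 0), exp_0; reflexivity. Qed.

Lemma Cexp_pow (z : C) (k : nat) : Cexp z ^ k = Cexp (RtoC (INR k) * z).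
Proof.
  induction k as [|k IH].
  - simpl. rewrite Cmult_0_l. symmetry; apply Cexp_0.
  - rewrite Cpow_S, IH, <- Cexp_plus, S_INR, RtoC_plus. f_equal; ring.
Qed.

(** The argument 2 e^(z/2) is chosen so that half of it has logarithm z/2: all
    powers of it are exponentials, without any choice of a branch. *)
Lemma half_pow_log_arg (z s : C) : half_pow (log_arg z) s = Cexp (s * (z / 2)).
Proof. unfold half_pow, log_arg. f_equal. ring. Qed.

Lemma half_pow_split (z : C) (k : nat) (s : C) :
  half_pow (log_arg z) (RtoC (INR (2 * k)) + s) = Cexp (s * (z / 2)) * Cexp z ^ k.
Proof.
  rewrite half_pow_log_arg, Cexp_pow, <- Cexp_plus, mult_INR, RtoC_mult.
  f_equal. simpl INR. replace (1 + 1)%R with 2%R by ring. field.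
Qed.

Lemma besselJ_unique (nu z l : C) (c : nat -> C) :
  (forall k, RtoC ((-1) ^ k)
      / (CGamma (RtoC (INR k + 1)) * CGamma (nu + RtoC (INR k + 1))) = c k) ->
  is_series (fun k => c k * Cexp z ^ k) l ->
  besselJ nu (log_arg z) = Cexp (nu * (z / 2)) * l.
Proof.
  intros Hc Hl. apply C_Series_unique.
  apply is_series_C_ext with (fun k => Cexp (nu * (z / 2)) * (c k * Cexp z ^ k)).
  - intros k. rewrite Hc, half_pow_split. ring.
  - apply is_series_C_scal, Hl.
Qed.

Lemma is_series_gamma_sum (w : nat -> R) (s : nat) (x : R) (t : C) :
  (forall k, (Rabs (w k) <= / INR (fact k))%R) -> (Rabs x <= 1 / 2)%R ->
  is_series (fun k => RtoC (w k * / rrising (1 + x) (k + s)) * t ^ k) (gamma_sum w s x t).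
Proof. intros; apply power_sum_correct, exp_bounded_gamma_sum; assumption. Qed.

(** Since 1/Gamma(m + x + k + 1) = (1/Gamma(1+x)) / ((1+x)...(k+m+x)), the factor
    1/Gamma(1+x) comes out of the series. *)
Lemma besselJ_near_nat (m : nat) (x : R) (z : C) :
  (Rabs x <= 1 / 2)%R ->
  besselJ (RtoC (INR m + x)) (log_arg z)
  = Cexp (RtoC (INR m + x) * (z / 2)) * (RtoC (rGamma1p x) * gamma_sum alt_inv_fact m x (Cexp z)).
Proof.
  intros Hx. apply besselJ_unique
    with (fun k => RtoC (rGamma1p x) * RtoC (alt_inv_fact k * / rrising (1 + x) (k + m))).
  - intros k. rewrite CGamma_fact, <- RtoC_plus.
    replace (INR m + x + (INR k + 1))%R with (x + (INR (k + m) + 1))%R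
      by (rewrite plus_INR; ring).
    rewrite CGamma_shifted by exact Hx.
    rewrite <- !RtoC_mult, <- RtoC_Rdiv. f_equal. unfold alt_inv_fact.
    pose proof (INR_fact_neq_0 k). pose proof (rrising_neq_0 x (k + m) Hx).
    assert (rGamma1p x <> 0)%R by (apply Rgt_not_eq, exp_pos).
    field. repeat split; assumption.
  - apply is_series_C_ext with (fun k => RtoC (rGamma1p x) *
      (RtoC (alt_inv_fact k * / rrising (1 + x) (k + m)) * Cexp z ^ k)); [intros k; ring|].
    apply is_series_C_scal, is_series_gamma_sum; [apply alt_inv_fact_bound|exact Hx].
Qed.

(** The first term, x/Gamma(1+x) = 1/Gamma(x), vanishes at x = 0 but has
    derivative 1 there: it is the source of the constant term of e^(z/2) Y1.
    In the remaining terms, shifted by one, the argument of Gamma is positive. *)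
Lemma besselJ_near_m1 (x : R) (z : C) :
  (Rabs x <= 1 / 2)%R -> x <> 0%R ->
  besselJ (RtoC (-1 + x)) (log_arg z)
  = Cexp (RtoC (-1 + x) * (z / 2)) *
    (RtoC (rGamma1p x) * (RtoC x - Cexp z * gamma_sum alt_inv_fact_succ 0 x (Cexp z))).
Proof.
  intros Hx H0.
  assert (Hg : (rGamma1p x <> 0)%R) by (apply Rgt_not_eq, exp_pos).
  set (c := fun k => match k with
    | O => RtoC (rGamma1p x) * RtoC x
    | S m => - RtoC (rGamma1p x) * RtoC (alt_inv_fact_succ m * / rrising (1 + x) (m + 0)) end).
  apply besselJ_unique with c.
  - intros [|k]; unfold c; rewrite CGamma_fact, <- RtoC_plus.
    + replace (-1 + x + (INR 0 + 1))%R with x by (simpl; ring).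
      rewrite CGamma_near_0 by assumption.
      rewrite <- !RtoC_mult, <- RtoC_Rdiv. f_equal. simpl. field. split; assumption.
    + replace (-1 + x + (INR (S k) + 1))%R with (x + (INR k + 1))%R
        by (rewrite S_INR; ring).
      rewrite CGamma_shifted by exact Hx.
      rewrite <- RtoC_opp, <- !RtoC_mult, <- RtoC_Rdiv. f_equal. unfold alt_inv_fact_succ.
      rewrite Nat.add_0_r. simpl pow.
      pose proof (INR_fact_neq_0 (S k)). pose proof (rrising_neq_0 x k Hx).
      field. repeat split; assumption.
  - replace (RtoC (rGamma1p x) * (RtoC x - Cexp z * gamma_sum alt_inv_fact_succ 0 x (Cexp z)))
      with (c O * Cexp z ^ 0 +
            (- RtoC (rGamma1p x) * Cexp z) * gamma_sum alt_inv_fact_succ 0 x (Cexp z))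
      by (simpl; ring).
    apply (proj1 (is_series_C_shift (fun k => c k * Cexp z ^ k) _)).
    apply is_series_C_ext with (fun k => (- RtoC (rGamma1p x) * Cexp z) *
      (RtoC (alt_inv_fact_succ k * / rrising (1 + x) (k + 0)) * Cexp z ^ k)).
    + intros k; unfold c; rewrite Cpow_S; ring.
    + apply is_series_C_scal, is_series_gamma_sum; [apply alt_inv_fact_succ_bound|exact Hx].
Qed.

(** * The limits that define Y0 and Y1 *)

(** The limit operator only looks at the horizontal line through [z]. *)
Lemma C_lim_real (f : C -> C) (z l : C) :
  (forall eps : R, (0 < eps)%R -> exists d : R, (0 < d)%R /\
     forall h : R, h <> 0%R -> (Rabs h < d)%R -> (Cmod (f (z + RtoC h)%C - l) < eps)%R) ->
  C_lim f z = l.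
Proof.
  intros H.
  assert (Hpt : forall x, (x, snd z) = z + RtoC (x - fst z)%R).
  { intros x; destruct z as [a b]; apply injective_projections; simpl; ring. }
  unfold C_lim.
  assert (E1 : Lim (fun x => fst (f (x, snd z))) (fst z) = fst l).
  { apply is_lim_unique, is_lim_spec. intros eps.
    destruct (H eps (cond_pos eps)) as [d [Hd Hd']].
    exists (mkposreal d Hd). intros x Hx Hne.
    assert (Hb : (Rabs (x - fst z) < d)%R) by exact Hx.
    specialize (Hd' (x - fst z)%R ltac:(lra) Hb). rewrite <- Hpt in Hd'.
    eapply Rle_lt_trans; [|exact Hd'].
    exact (re_le_Cmod (f (x, snd z) - l)). }
  assert (E2 : Lim (fun x => snd (f (x, snd z))) (fst z) = snd l).
  { apply is_lim_unique, is_lim_spec. intros eps.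
    destruct (H eps (cond_pos eps)) as [d [Hd Hd']].
    exists (mkposreal d Hd). intros x Hx Hne.
    assert (Hb : (Rabs (x - fst z) < d)%R) by exact Hx.
    specialize (Hd' (x - fst z)%R ltac:(lra) Hb). rewrite <- Hpt in Hd'.
    eapply Rle_lt_trans; [|exact Hd'].
    exact (im_le_Cmod (f (x, snd z) - l)). }
  rewrite E1, E2. destruct l; reflexivity.
Qed.

Lemma expands_quotient_lim (f g : R -> C) (a b : C) :
  b <> 0 ->
  expands Rabs f 0 (fun x => a * RtoC x) -> expands Rabs g 0 (fun x => b * RtoC x) ->
  forall eps : R, (0 < eps)%R -> exists d : R, (0 < d)%R /\
    forall x : R, x <> 0%R -> (Rabs x < d)%R -> (Cmod (f x / g x - a / b) < eps)%R.
Proof.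
  intros Hb [_ Hf] [_ Hg] eps Heps.
  pose proof (proj1 (Cmod_gt_0 b) Hb) as Hm. pose proof (Cmod_ge_0 a) as Ha.
  set (m := Cmod b) in *. set (s := (m + Cmod a)%R). assert (Hs : (0 < s)%R) by (unfold s; lra).
  set (eta := Rmin (m / 2) (eps * (m * m) / (4 * s))).
  assert (Heta : (0 < eta)%R).
  { apply Rmin_glb_lt; [lra|]. apply Rdiv_lt_0_compat; [|lra].
    repeat apply Rmult_lt_0_compat; assumption. }
  assert (Heta1 : (eta <= m / 2)%R) by apply Rmin_l.
  assert (Heta2 : (eta * s <= eps * (m * m) / 4)%R).
  { replace (eps * (m * m) / 4)%R with (eps * (m * m) / (4 * s) * s)%R by (field; lra).
    apply Rmult_le_compat_r; [lra|apply Rmin_r]. }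
  destruct (Hf eta Heta) as [d1 [Hd1 H1]], (Hg eta Heta) as [d2 [Hd2 H2]].
  exists (Rmin d1 d2); split; [apply Rmin_glb_lt; assumption|].
  intros x Hx Hxd. pose proof (Rmin_l d1 d2); pose proof (Rmin_r d1 d2).
  specialize (H1 x ltac:(lra)); specialize (H2 x ltac:(lra)).
  pose proof (Rabs_pos_lt x Hx) as Hx0.
  set (e1 := f x - 0 - a * x) in *. set (e2 := g x - 0 - b * x) in *.
  assert (Hgx : (m / 2 * Rabs x <= Cmod (g x))%R).
  { pose proof (Cmod_triangle (g x) (- e2)) as Q. rewrite Cmod_opp in Q.
    replace (g x + - e2) with (b * x) in Q by (unfold e2; ring).
    rewrite Cmod_mult, Cmod_R in Q. fold m in Q.
    assert (eta * Rabs x <= m / 2 * Rabs x)%R by (apply Rmult_le_compat_r; lra). lra. }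
  assert (Hgx0 : (0 < m / 2 * Rabs x)%R) by (apply Rmult_lt_0_compat; lra).
  assert (Hg0 : g x <> 0).
  { intros E. rewrite E, Cmod_0 in Hgx. lra. }
  replace (f x / g x - a / b) with ((e1 * b - a * e2) / (b * g x))
    by (unfold e1, e2; field; split; assumption).
  rewrite Cmod_div by (apply Cmult_neq_0; assumption). rewrite Cmod_mult. fold m.
  apply Rlt_div_l; [apply Rmult_lt_0_compat; lra|].
  apply Rle_lt_trans with (eta * s * Rabs x)%R.
  - unfold Cminus. eapply Rle_trans; [apply Cmod_triangle|].
    rewrite Cmod_opp, !Cmod_mult. fold m.
    assert (Cmod e1 * m <= eta * Rabs x * m)%R by (apply Rmult_le_compat_r; lra).
    assert (Cmod a * Cmod e2 <= Cmod a * (eta * Rabs x))%R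
      by (apply Rmult_le_compat_l; lra).
    unfold s. lra.
  - apply Rle_lt_trans with (eps * (m * m) / 4 * Rabs x)%R; [apply Rmult_le_compat_r; lra|].
    apply Rlt_le_trans with (eps * (m * (m / 2 * Rabs x)))%R.
    + assert (0 < eps * (m * m) * Rabs x)%R by (repeat apply Rmult_lt_0_compat; lra). lra.
    + apply Rmult_le_compat_l; [lra|]. apply Rmult_le_compat_l; lra.
Qed.

Lemma Cexp_Ci (y : R) : Cexp (Ci * RtoC y) = RtoC (cos y) + Ci * RtoC (sin y).
Proof.
  unfold Cexp; simpl.
  replace (0 * y - 1 * 0)%R with 0%R by ring. replace (0 * 0 + 1 * y)%R with y by ring.
  rewrite exp_0. apply injective_projections; simpl; ring.
Qed.

Lemma Cexp_mCi (y : R) : Cexp (- (Ci * RtoC y)) = RtoC (cos y) - Ci * RtoC (sin y).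
Proof.
  replace (- (Ci * RtoC y)) with (Ci * RtoC (- y)) by (rewrite RtoC_opp; ring).
  rewrite Cexp_Ci, cos_neg, sin_neg, RtoC_opp; ring.
Qed.

Lemma Ccos_RtoC (y : R) : Ccos (RtoC y) = RtoC (cos y).
Proof. unfold Ccos. rewrite Cexp_Ci, Cexp_mCi. field. Qed.

Lemma Csin_RtoC (y : R) : Csin (RtoC y) = RtoC (sin y).
Proof. unfold Csin. rewrite Cexp_Ci, Cexp_mCi. field. apply Ci_nz. Qed.

Lemma expands_cos_PI : expands Rabs (fun x => RtoC (cos (x * PI))) 1 (fun x => 0 * RtoC x).
Proof.
  eapply expands_ext.
  - apply (expands_RtoC (fun x => cos (x * PI)) 0 (- (PI * sin (0 * PI)))).
    auto_derive; [exact I|ring].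
  - intros x; simpl; rewrite Rplus_0_l; reflexivity.
  - rewrite Rmult_0_l, cos_0; reflexivity.
  - intros x; simpl. rewrite Rmult_0_l, sin_0, Rmult_0_r, Ropp_0; reflexivity.
Qed.

Lemma expands_sin_PI : expands Rabs (fun x => RtoC (sin (x * PI))) 0 (fun x => RtoC PI * RtoC x).
Proof.
  eapply expands_ext.
  - apply (expands_RtoC (fun x => sin (x * PI)) 0 (PI * cos (0 * PI))).
    auto_derive; [exact I|ring].
  - intros x; simpl; rewrite Rplus_0_l; reflexivity.
  - rewrite Rmult_0_l, sin_0; reflexivity.
  - intros x; simpl. rewrite Rmult_0_l, cos_0, Rmult_1_r; reflexivity.
Qed.

Lemma expands_Rneg (f : R -> C) (a b : C) :
  expands Rabs f a (fun x => b * RtoC x) ->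
  expands Rabs (fun x => f (- x)%R) a (fun x => - b * RtoC x).
Proof.
  intros H. eapply expands_ext.
  - apply (expands_precomp Rabs Rabs Ropp 1) with (3 := H); [lra|].
    intros x. rewrite Rabs_Ropp. pose proof (Rabs_pos x); lra.
  - reflexivity.
  - reflexivity.
  - intros x; simpl. rewrite RtoC_opp; ring.
Qed.

(** With F(x) = J_(n+x) and G(x) = (-1)^(n+1) J_(-n+x) the quotient is Y_(n+x).
    Numerator and denominator vanish at x = 0, and the limit is the quotient of
    their derivatives. *)
Lemma bessel_second_kind_limit (F G : R -> C) (a b c : C) :
  expands Rabs F a (fun x => b * RtoC x) ->
  expands Rabs G (- a) (fun x => c * RtoC x) ->
  forall eps : R, (0 < eps)%R -> exists d : R, (0 < d)%R /\
    forall x : R, x <> 0%R -> (Rabs x < d)%R ->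
      (Cmod ((F x * RtoC (cos (x * PI)) + G (- x)%R) / RtoC (sin (x * PI))
             - (b - c) / RtoC PI) < eps)%R.
Proof.
  intros HF HG. apply expands_quotient_lim.
  - intros E. apply RtoC_inj in E. pose proof PI_RGT_0; lra.
  - eapply expands_ext.
    + apply expands_plus; [|apply expands_Rneg, HG].
      apply expands_mult; [apply Rabs_pos|exact HF|apply expands_cos_PI].
    + reflexivity.
    + ring.
    + intros x; simpl; ring.
  - apply expands_sin_PI.
Qed.

Lemma C_lim_shift_ext (f : C -> C) (n : R) (g : R -> C) (r : R) (l : C) :
  (0 < r)%R ->
  (forall x : R, x <> 0%R -> (Rabs x < r)%R -> f (RtoC (n + x)) = g x) ->
  (forall eps : R, (0 < eps)%R -> exists d : R, (0 < d)%R /\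
    forall x : R, x <> 0%R -> (Rabs x < d)%R -> (Cmod (g x - l) < eps)%R) ->
  C_lim f (RtoC n) = l.
Proof.
  intros Hr Hfg Hg. apply C_lim_real. intros eps Heps.
  destruct (Hg eps Heps) as [d [Hd Hd']].
  exists (Rmin d r); split; [apply Rmin_glb_lt; assumption|].
  intros h Hh Hhd. pose proof (Rmin_l d r); pose proof (Rmin_r d r).
  rewrite <- RtoC_plus, Hfg by (assumption || lra). apply Hd'; [assumption|lra].
Qed.

(** With t = e^z, the first two are J0 and e^(-z/2) J1 at 2 e^(z/2); the
    harmonic sums are the derivatives with respect to the order, at the orders 0,
    1 and -1, of the corresponding power series. *)
Definition J0_sum (t : C) : C := power_sum (fact_coef alt_inv_fact 0) t.
Definition J1_sum (t : C) : C := power_sum (fact_coef alt_inv_fact 1) t.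
Definition J0_harmonic_sum (t : C) : C := power_sum (harmonic_coef alt_inv_fact 0) t.
Definition J1_harmonic_sum (t : C) : C := power_sum (harmonic_coef alt_inv_fact 1) t.
Definition Jm1_harmonic_sum (t : C) : C := power_sum (harmonic_coef alt_inv_fact_succ 0) t.

(** This factor is common to all J_(n+x), up to e^(n z/2): its derivative
    euler_gamma + z/2 is where the logarithmic term of Y0 and Y1 comes from. *)
Lemma expands_exp_factor (z : C) :
  expands Rabs (fun x => RtoC (rGamma1p x) * Cexp (RtoC x * (z / 2))) 1
    (fun x => (RtoC euler_gamma + z / 2) * RtoC x).
Proof.
  assert (H : expands Rabs (fun x => RtoC x * (z / 2)) 0 (fun x => RtoC x * (z / 2))).
  { apply (expands_linear Rabs Rabs_pos _ (Cmod (z / 2))).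
    intros x; rewrite Cmod_mult, Cmod_R; lra. }
  eapply expands_ext.
  - apply expands_mult; [apply Rabs_pos|apply expands_rGamma1p|].
    apply (expands_comp Rabs Rabs_pos Cexp (Cexp 0) 0); [apply expands_Cexp|exact H].
  - reflexivity.
  - rewrite Cexp_0; ring.
  - intros x; simpl. rewrite Cexp_0. ring.
Qed.

Lemma power_sum_ext (c d : nat -> C) (t : C) :
  (forall k, c k = d k) -> power_sum c t = power_sum d t.
Proof.
  intros H. unfold power_sum, C_Series, C_lim_seq.
  f_equal; f_equal; apply Lim_seq_ext; intros n; f_equal; apply sum_n_ext;
    intros k; rewrite H; reflexivity.
Qed.

(** This is J_(-1) = - J_1: the two families of coefficients agree at x = 0. *)
Lemma J1_sum_alt (t : C) : power_sum (fact_coef alt_inv_fact_succ 0) t = J1_sum t.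
Proof.
  apply power_sum_ext. intros k; unfold fact_coef, alt_inv_fact, alt_inv_fact_succ. f_equal.
  rewrite Nat.add_0_r, Nat.add_1_r. unfold Rdiv; ring.
Qed.

Lemma besselJ_0 (z : C) : besselJ (RtoC 0) (log_arg z) = J0_sum (Cexp z).
Proof.
  pose proof (besselJ_near_nat 0 0 z ltac:(rewrite Rabs_R0; lra)) as H.
  simpl INR in H. rewrite Rplus_0_l in H. rewrite H.
  rewrite Cmult_0_l, Cexp_0, rGamma1p_0.
  unfold J0_sum, gamma_sum. rewrite !Cmult_1_l.
  apply power_sum_ext; intros k. unfold fact_coef. rewrite rrising_1. reflexivity.
Qed.

Lemma besselJ_1 (z : C) :
  Cexp (z / 2) * besselJ (RtoC 1) (log_arg z) = Cexp z * J1_sum (Cexp z).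
Proof.
  pose proof (besselJ_near_nat 1 0 z ltac:(rewrite Rabs_R0; lra)) as H.
  simpl INR in H. rewrite Rplus_0_r in H. rewrite H.
  rewrite Cmult_1_l, rGamma1p_0, Cmult_1_l, Cmult_assoc, <- Cexp_plus.
  replace (z / 2 + z / 2) with z by field. f_equal.
  apply power_sum_ext; intros k. unfold fact_coef. rewrite rrising_1. reflexivity.
Qed.

(** [uY] and [vY] are Y0 and e^(z/2) Y1 at 2 e^(z/2), in closed form. *)
Definition uY (z : C) : C :=
  2 / PI * ((RtoC euler_gamma + z / 2) * J0_sum (Cexp z) + J0_harmonic_sum (Cexp z)).
Definition vY (z : C) : C :=
  2 / PI * ((RtoC euler_gamma + z / 2) * (Cexp z * J1_sum (Cexp z))
            + Cexp z * J1_harmonic_sum (Cexp z) - J0_sum (Cexp z) / 2).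

Lemma RtoC_PI_neq_0 : RtoC PI <> 0.
Proof. intros E; apply RtoC_inj in E. pose proof PI_RGT_0; lra. Qed.

Lemma expands_J0 (z : C) :
  expands Rabs (fun x => Cexp (RtoC x * (z / 2)) *
      (RtoC (rGamma1p x) * gamma_sum alt_inv_fact 0 x (Cexp z)))
    (J0_sum (Cexp z))
    (fun x => ((RtoC euler_gamma + z / 2) * J0_sum (Cexp z) + J0_harmonic_sum (Cexp z)) * RtoC x).
Proof.
  eapply expands_ext.
  - apply expands_mult; [apply Rabs_pos|apply (expands_exp_factor z)|].
    apply (expands_gamma_sum alt_inv_fact 0 (Cexp z) alt_inv_fact_bound).
  - intros x; simpl; ring.
  - fold (J0_sum (Cexp z)); ring.
  - intros x; simpl; fold (J0_sum (Cexp z)) (J0_harmonic_sum (Cexp z)); ring.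
Qed.

Lemma besselY_0 (z : C) : besselY 0 (log_arg z) = uY z.
Proof.
  set (F := fun x => Cexp (RtoC x * (z / 2)) *
      (RtoC (rGamma1p x) * gamma_sum alt_inv_fact 0 x (Cexp z))).
  apply C_lim_shift_ext with
    (g := fun x => (F x * RtoC (cos (x * PI)) + - F (- x)%R) / RtoC (sin (x * PI)))
    (r := (1 / 2)%R).
  - lra.
  - intros x Hx Hxr. rewrite Rplus_0_l. unfold besselY_nonint.
    rewrite <- RtoC_mult, Ccos_RtoC, Csin_RtoC.
    pose proof (besselJ_near_nat 0 x z ltac:(lra)) as H1.
    pose proof (besselJ_near_nat 0 (- x)%R z ltac:(rewrite Rabs_Ropp; lra)) as H2.
    simpl INR in H1, H2. rewrite Rplus_0_l in H1, H2.
    rewrite <- RtoC_opp, H1, H2. reflexivity.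
  - pose proof (expands_J0 z) as HF. fold F in HF.
    set (b := (RtoC euler_gamma + z / 2) * J0_sum (Cexp z) + J0_harmonic_sum (Cexp z)) in *.
    assert (HG : expands Rabs (fun x => - F x) (- J0_sum (Cexp z)) (fun x => (- b) * RtoC x)).
    { eapply expands_ext.
      - apply (expands_scal Rabs Rabs_pos (-(1))), HF.
      - intros x; simpl; ring.
      - ring.
      - intros x; simpl; ring. }
    replace (uY z) with ((b - - b) / RtoC PI)
      by (unfold uY; fold b; field; apply RtoC_PI_neq_0).
    exact (bessel_second_kind_limit F (fun x => - F x) _ _ _ HF HG).
Qed.

(** The coefficients with H_(k+1) and with H_k differ by 1/(k+1), which turns
    those of J1 into those of - J0 shifted by one.  The identity reconciles the
    expression of Y1, to which the orders 1 and -1 both contribute, with -Y0'. *)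
Lemma J0_sum_from_harmonic_sums (t : C) :
  1 + t * (J1_harmonic_sum t - Jm1_harmonic_sum t) = J0_sum t.
Proof.
  symmetry; apply C_Series_unique.
  replace (1 + t * (J1_harmonic_sum t - Jm1_harmonic_sum t))
    with (fact_coef alt_inv_fact 0 0 * t ^ 0 + t * (J1_harmonic_sum t - Jm1_harmonic_sum t)).
  2:{ unfold fact_coef, alt_inv_fact. simpl. replace (1 / 1 * / 1)%R with 1%R by field. ring. }
  apply (proj1 (is_series_C_shift (fun k => fact_coef alt_inv_fact 0 k * t ^ k) _)).
  apply is_series_C_ext with
    (fun k => t * (harmonic_coef alt_inv_fact 1 k * t ^ k
                   - harmonic_coef alt_inv_fact_succ 0 k * t ^ k)).
  - intros k. rewrite Cpow_S.
    replace (fact_coef alt_inv_fact 0 (S k))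
      with (harmonic_coef alt_inv_fact 1 k - harmonic_coef alt_inv_fact_succ 0 k);
      [ring|].
    unfold harmonic_coef, fact_coef, alt_inv_fact, alt_inv_fact_succ.
    rewrite <- RtoC_minus. f_equal.
    rewrite !Nat.add_0_r, Nat.add_1_r.
    change (harmonic (S k)) with (harmonic k + / INR (S k))%R.
    rewrite fact_simpl, mult_INR. simpl pow.
    pose proof (INR_fact_neq_0 k). pose proof (not_0_INR (S k) ltac:(lia)).
    field. split; assumption.
  - apply is_series_C_scal, is_series_C_minus; apply power_sum_correct;
      apply exp_bounded_harmonic_coef; [apply alt_inv_fact_bound|apply alt_inv_fact_succ_bound].
Qed.

(** At nu = 1 + x one has cos (nu pi) = - cos (x pi) and sin (nu pi) =
    - sin (x pi), so Y_nu = (J_(1+x) cos (x pi) + J_(-1-x)) / sin (x pi). *)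
Lemma besselY_1 (z : C) : Cexp (z / 2) * besselY 1 (log_arg z) = vY z.
Proof.
  set (t := Cexp z). set (q := Cexp (z / 2)).
  assert (Hq : q <> 0).
  { intros E. assert (A : q * Cexp (- (z / 2)) = 1).
    { unfold q. rewrite <- Cexp_plus, <- Cexp_0. f_equal; ring. }
    rewrite E, Cmult_0_l in A. apply C1_nz. symmetry; exact A. }
  set (E := fun x => RtoC (rGamma1p x) * Cexp (RtoC x * (z / 2))).
  set (F := fun x => E x * (t * gamma_sum alt_inv_fact 1 x t) / q).
  set (G := fun x => E x * (RtoC x - t * gamma_sum alt_inv_fact_succ 0 x t) / q).
  set (L := RtoC euler_gamma + z / 2).
  assert (HE : expands Rabs E 1 (fun x => L * RtoC x)) by apply expands_exp_factor.
  assert (HF : expands Rabs F (t * J1_sum t / q)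
                 (fun x => ((L * (t * J1_sum t) + t * J1_harmonic_sum t) / q) * RtoC x)).
  { eapply expands_ext.
    - apply (expands_scal Rabs Rabs_pos (/ q)).
      apply expands_mult; [apply Rabs_pos|exact HE|].
      apply (expands_scal Rabs Rabs_pos t),
        (expands_gamma_sum alt_inv_fact 1 t alt_inv_fact_bound).
    - intros x; unfold F; simpl; field; exact Hq.
    - fold (J1_sum t). field; exact Hq.
    - intros x; simpl. fold (J1_sum t) (J1_harmonic_sum t). field; exact Hq. }
  assert (HX : expands Rabs (fun x => RtoC x) 0 (fun x => RtoC x)).
  { apply (expands_linear Rabs Rabs_pos _ 1). intros x; rewrite Cmod_R; lra. }
  assert (HG : expands Rabs G (- (t * J1_sum t / q))
                 (fun x => ((1 - L * (t * J1_sum t) - t * Jm1_harmonic_sum t) / q) * RtoC x)).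
  { eapply expands_ext.
    - apply (expands_scal Rabs Rabs_pos (/ q)).
      apply expands_mult; [apply Rabs_pos|exact HE|].
      apply expands_minus; [apply Rabs_pos|exact HX|].
      apply (expands_scal Rabs Rabs_pos t),
        (expands_gamma_sum alt_inv_fact_succ 0 t alt_inv_fact_succ_bound).
    - intros x; unfold G; simpl; field; exact Hq.
    - rewrite J1_sum_alt. field; exact Hq.
    - intros x; simpl. rewrite J1_sum_alt. fold (Jm1_harmonic_sum t). field; exact Hq. }
  assert (Hlim : besselY 1 (log_arg z)
    = ((L * (t * J1_sum t) + t * J1_harmonic_sum t) / q
       - (1 - L * (t * J1_sum t) - t * Jm1_harmonic_sum t) / q) / RtoC PI).
  { apply C_lim_shift_ext with
      (g := fun x => (F x * RtoC (cos (x * PI)) + G (- x)%R) / RtoC (sin (x * PI)))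
      (r := (1 / 2)%R).
    - lra.
    - intros x Hx Hxr. unfold besselY_nonint.
      rewrite <- RtoC_mult, Ccos_RtoC, Csin_RtoC.
      replace ((1 + x) * PI)%R with (x * PI + PI)%R by ring.
      rewrite neg_cos, neg_sin.
      pose proof (besselJ_near_nat 1 x z ltac:(lra)) as H1.
      pose proof (besselJ_near_m1 (- x)%R z ltac:(rewrite Rabs_Ropp; lra) ltac:(lra)) as H2.
      simpl INR in H1.
      rewrite <- RtoC_opp. replace (- (1 + x))%R with (-1 + - x)%R by ring.
      rewrite H1, H2. fold t.
      assert (Ha : Cexp (RtoC (1 + x) * (z / 2)) = Cexp (RtoC x * (z / 2)) * (t / q)).
      { replace t with (q * q); [|unfold q, t; rewrite <- Cexp_plus; f_equal; field].
        replace (q * q / q) with q by (field; exact Hq). unfold q.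
        rewrite <- Cexp_plus, RtoC_plus. f_equal; ring. }
      assert (Hb : Cexp (RtoC (-1 + - x) * (z / 2)) = Cexp (RtoC (- x) * (z / 2)) / q).
      { replace (Cexp (RtoC (- x) * (z / 2)))
          with (Cexp (RtoC (-1 + - x) * (z / 2)) * q); [field; exact Hq|].
        unfold q. rewrite <- Cexp_plus, RtoC_plus. f_equal; ring. }
      rewrite Ha, Hb. unfold F, G, E. rewrite !RtoC_opp.
      assert (Hs : RtoC (sin (x * PI)) <> 0).
      { intros Es; apply RtoC_inj in Es. apply Rabs_lt_between in Hxr.
        pose proof PI_RGT_0.
        destruct (Rtotal_order x 0) as [Hn|[Hn|Hn]]; [|lra|].
        - assert (0 < sin (- (x * PI)))%R by (apply sin_gt_0; nra).
          rewrite sin_neg in *; lra.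
        - assert (0 < sin (x * PI))%R by (apply sin_gt_0; nra). lra. }
      field. split; assumption.
    - exact (bessel_second_kind_limit F G _ _ _ HF HG). }
  rewrite Hlim. unfold vY. fold t L. rewrite <- (J0_sum_from_harmonic_sums t).
  field. split; [apply RtoC_PI_neq_0|exact Hq].
Qed.

(** * Two solutions of the Hill equation *)

Definition has_deriv (f : C -> C) (z l : C) : Prop :=
  expands Cmod (fun h => f (z + h)) (f z) (fun h => l * h).

Lemma expands_Cmod_id : expands Cmod (fun h => h) 0 (fun h => h).
Proof. apply (expands_linear Cmod Cmod_ge_0 _ 1). intros h; lra. Qed.

Lemma has_deriv_add_half (c z : C) : has_deriv (fun z => c + z / 2) z (/ 2).
Proof.
  eapply expands_ext.
  - apply expands_plus; [apply (expands_const Cmod Cmod_ge_0 (c + z / 2))|].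
    apply (expands_scal Cmod Cmod_ge_0 (/ 2)), expands_Cmod_id.
  - intros h; simpl; field.
  - ring.
  - intros h; simpl; ring.
Qed.

Lemma has_deriv_power_exp (c : nat -> C) (z : C) :
  exp_bounded c ->
  has_deriv (fun z => power_sum c (Cexp z)) z
    (Cexp z * power_sum (derived_coef c) (Cexp z)).
Proof.
  intros Hc. eapply expands_ext.
  - apply (expands_comp Cmod Cmod_ge_0 (power_sum c)).
    + apply expands_power_sum, Hc.
    + apply expands_Cexp.
  - reflexivity.
  - reflexivity.
  - intros h; simpl; ring.
Qed.

Lemma has_deriv_eq (f g : C -> C) (z l m : C) :
  has_deriv f z l -> (forall z, f z = g z) -> l = m -> has_deriv g z m.
Proof.
  intros H Hf <-. eapply expands_ext; [exact H| | |reflexivity].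
  - intros h; apply Hf.
  - apply Hf.
Qed.

Lemma has_deriv_plus (f g : C -> C) (z l m : C) :
  has_deriv f z l -> has_deriv g z m -> has_deriv (fun z => f z + g z) z (l + m).
Proof.
  intros Hf Hg. eapply expands_ext; [apply (expands_plus _ _ _ _ _ _ _ Hf Hg)|reflexivity..|].
  intros h; simpl; ring.
Qed.

Lemma has_deriv_mult (f g : C -> C) (z l m : C) :
  has_deriv f z l -> has_deriv g z m -> has_deriv (fun z => f z * g z) z (l * g z + f z * m).
Proof.
  intros Hf Hg. eapply expands_ext;
    [apply (expands_mult _ Cmod_ge_0 _ _ _ _ _ _ Hf Hg)|reflexivity..|].
  intros h; simpl; ring.
Qed.

Lemma has_deriv_scal (c : C) (f : C -> C) (z l : C) :
  has_deriv f z l -> has_deriv (fun z => c * f z) z (c * l).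
Proof.
  intros Hf. eapply expands_ext;
    [apply (expands_scal _ Cmod_ge_0 c _ _ _ Hf)|reflexivity..|].
  intros h; simpl; ring.
Qed.

Lemma power_sum_scal (a : C) (c : nat -> C) (t : C) :
  exp_bounded c -> power_sum (fun k => a * c k) t = a * power_sum c t.
Proof.
  intros Hc. apply C_Series_unique.
  apply is_series_C_ext with (fun k => a * (c k * t ^ k)); [intros k; ring|].
  apply is_series_C_scal, power_sum_correct, Hc.
Qed.

(** Both sides are the derivative of t f(t), for f(t) = sum c_k t^k. *)
Lemma power_sum_mul_var (c : nat -> C) (t : C) :
  exp_bounded c ->
  power_sum c t + t * power_sum (derived_coef c) t
  = power_sum (fun k => RtoC (INR (S k)) * c k) t.
Proof.
  intros Hc. symmetry. apply C_Series_unique.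
  apply is_series_C_ext with (fun k => c k * t ^ k + RtoC (INR k) * c k * t ^ k).
  - intros k. rewrite S_INR, RtoC_plus. ring.
  - apply is_series_C_plus; [apply power_sum_correct, Hc|].
    replace (t * power_sum (derived_coef c) t)
      with (RtoC (INR 0) * c O * t ^ 0 + t * power_sum (derived_coef c) t)
      by (simpl; ring).
    apply (proj1 (is_series_C_shift (fun k => RtoC (INR k) * c k * t ^ k) _)).
    apply is_series_C_ext with (fun k => t * (derived_coef c k * t ^ k)).
    + intros k; unfold derived_coef; rewrite Cpow_S; ring.
    + apply is_series_C_scal, power_sum_correct, exp_bounded_derived, Hc.
Qed.

Lemma J0_sum_derived (t : C) : power_sum (derived_coef (fact_coef alt_inv_fact 0)) t = - J1_sum t.
Proof.
  replace (- J1_sum t) with (-(1) * J1_sum t) by ring. unfold J1_sum.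
  rewrite <- power_sum_scal by (apply exp_bounded_fact_coef, alt_inv_fact_bound).
  apply power_sum_ext; intros k. unfold derived_coef, fact_coef, alt_inv_fact.
  rewrite Nat.add_0_r, Nat.add_1_r, <- RtoC_mult, <- RtoC_opp, <- RtoC_mult. f_equal.
  rewrite (fact_simpl k), mult_INR. simpl pow.
  pose proof (INR_fact_neq_0 k). pose proof (not_0_INR (S k) ltac:(lia)).
  field. split; assumption.
Qed.

Lemma J0_harmonic_sum_derived (t : C) :
  power_sum (derived_coef (harmonic_coef alt_inv_fact 0)) t = - J1_harmonic_sum t.
Proof.
  replace (- J1_harmonic_sum t) with (-(1) * J1_harmonic_sum t) by ring. unfold J1_harmonic_sum.
  rewrite <- power_sum_scal by (apply exp_bounded_harmonic_coef, alt_inv_fact_bound).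
  apply power_sum_ext; intros k. unfold derived_coef, harmonic_coef, alt_inv_fact.
  rewrite Nat.add_0_r, Nat.add_1_r, <- RtoC_mult, <- RtoC_opp, <- RtoC_mult. f_equal.
  rewrite (fact_simpl k), mult_INR. simpl pow.
  pose proof (INR_fact_neq_0 k). pose proof (not_0_INR (S k) ltac:(lia)).
  field. split; assumption.
Qed.

Lemma J1_sum_var_derived (t : C) :
  J1_sum t + t * power_sum (derived_coef (fact_coef alt_inv_fact 1)) t = J0_sum t.
Proof.
  unfold J1_sum. rewrite power_sum_mul_var by (apply exp_bounded_fact_coef, alt_inv_fact_bound).
  apply power_sum_ext; intros k. unfold fact_coef, alt_inv_fact.
  rewrite Nat.add_0_r, Nat.add_1_r, <- RtoC_mult. f_equal.
  rewrite (fact_simpl k), mult_INR.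
  pose proof (INR_fact_neq_0 k). pose proof (not_0_INR (S k) ltac:(lia)).
  field. split; assumption.
Qed.

Lemma J1_harmonic_sum_var_derived (t : C) :
  J1_harmonic_sum t + t * power_sum (derived_coef (harmonic_coef alt_inv_fact 1)) t
  = J0_harmonic_sum t - J1_sum t.
Proof.
  unfold J1_harmonic_sum. rewrite power_sum_mul_var
    by (apply exp_bounded_harmonic_coef, alt_inv_fact_bound).
  apply C_Series_unique.
  apply is_series_C_ext with
    (fun k => harmonic_coef alt_inv_fact 0 k * t ^ k - fact_coef alt_inv_fact 1 k * t ^ k).
  - intros k.
    replace (RtoC (INR (S k)) * harmonic_coef alt_inv_fact 1 k)
      with (harmonic_coef alt_inv_fact 0 k - fact_coef alt_inv_fact 1 k); [ring|].
    unfold harmonic_coef, fact_coef, alt_inv_fact.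
    rewrite Nat.add_0_r, Nat.add_1_r, <- RtoC_mult, <- RtoC_minus. f_equal.
    change (harmonic (S k)) with (harmonic k + / INR (S k))%R.
    rewrite (fact_simpl k), mult_INR.
    pose proof (INR_fact_neq_0 k). pose proof (not_0_INR (S k) ltac:(lia)).
    field. split; assumption.
  - apply is_series_C_minus; apply power_sum_correct;
      [apply exp_bounded_harmonic_coef|apply exp_bounded_fact_coef]; apply alt_inv_fact_bound.
Qed.

(** The companion solution of [uY], with vJ = - uJ'. *)
Definition uJ (z : C) : C := J0_sum (Cexp z).
Definition vJ (z : C) : C := Cexp z * J1_sum (Cexp z).

Lemma has_deriv_uJ (z : C) : has_deriv uJ z (- vJ z).
Proof.
  eapply has_deriv_eq.
  - apply (has_deriv_power_exp (fact_coef alt_inv_fact 0)),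
      exp_bounded_fact_coef, alt_inv_fact_bound.
  - reflexivity.
  - rewrite J0_sum_derived. unfold vJ. ring.
Qed.

Lemma has_deriv_vJ (z : C) : has_deriv vJ z (Cexp z * uJ z).
Proof.
  eapply has_deriv_eq.
  - apply has_deriv_mult; [apply expands_Cexp|].
    apply (has_deriv_power_exp (fact_coef alt_inv_fact 1)),
      exp_bounded_fact_coef, alt_inv_fact_bound.
  - reflexivity.
  - cbv beta. fold (J1_sum (Cexp z)). unfold uJ. rewrite <- J1_sum_var_derived. ring.
Qed.

Lemma has_deriv_exp_J1_harmonic_sum (z : C) :
  has_deriv (fun z => Cexp z * J1_harmonic_sum (Cexp z)) z
    (Cexp z * (J0_harmonic_sum (Cexp z) - J1_sum (Cexp z))).
Proof.
  eapply has_deriv_eq.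
  - apply has_deriv_mult; [apply expands_Cexp|].
    apply (has_deriv_power_exp (harmonic_coef alt_inv_fact 1)),
      exp_bounded_harmonic_coef, alt_inv_fact_bound.
  - reflexivity.
  - cbv beta. fold (J1_harmonic_sum (Cexp z)). rewrite <- J1_harmonic_sum_var_derived. ring.
Qed.

Lemma has_deriv_uY (z : C) : has_deriv uY z (- vY z).
Proof.
  eapply has_deriv_eq.
  - apply (has_deriv_scal (2 / PI)). apply has_deriv_plus.
    + apply has_deriv_mult; [apply (has_deriv_add_half euler_gamma)|apply has_deriv_uJ].
    + apply (has_deriv_power_exp (harmonic_coef alt_inv_fact 0)),
        exp_bounded_harmonic_coef, alt_inv_fact_bound.
  - reflexivity.
  - rewrite J0_harmonic_sum_derived. unfold vY, uJ, vJ. field. apply RtoC_PI_neq_0.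
Qed.

Lemma has_deriv_vY (z : C) : has_deriv vY z (Cexp z * uY z).
Proof.
  eapply has_deriv_eq.
  - apply (has_deriv_scal (2 / PI)). apply has_deriv_plus; [apply has_deriv_plus|].
    + apply has_deriv_mult; [apply (has_deriv_add_half euler_gamma)|apply has_deriv_vJ].
    + apply has_deriv_exp_J1_harmonic_sum.
    + apply (has_deriv_scal (- / 2)), has_deriv_uJ.
  - intros y. unfold vY, uJ, vJ, Cdiv. ring.
  - unfold uY, uJ, vJ. field. apply RtoC_PI_neq_0.
Qed.

Lemma Cexp_2PI (z : C) : Cexp (z + 2 * PI * Ci) = Cexp z.
Proof.
  rewrite Cexp_plus. replace (2 * PI * Ci) with (Ci * RtoC (2 * PI)) by (rewrite RtoC_mult; ring).
  rewrite Cexp_Ci, cos_2PI, sin_2PI. ring.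
Qed.

Lemma uJ_period (z : C) : uJ (z + 2 * PI * Ci) = uJ z.
Proof. unfold uJ; rewrite Cexp_2PI; reflexivity. Qed.

(** Going once around the origin in the variable e^z only affects the term
    (2/pi) (z/2) uJ of [uY]. *)
Lemma uY_monodromy (z : C) : uY (z + 2 * PI * Ci) = uY z + 2 * Ci * uJ z.
Proof. unfold uY, uJ; rewrite Cexp_2PI. field. apply RtoC_PI_neq_0. Qed.

Lemma uJ_not_zero : exists z, uJ z <> 0.
Proof.
  pose proof (expands_power_sum (fact_coef alt_inv_fact 0) 0
                (exp_bounded_fact_coef alt_inv_fact 0 alt_inv_fact_bound)) as H.
  destruct (expands_lipschitz Cmod Cmod_ge_0 _ _ _ H) as [K [d [HK [Hd HL]]]].
  assert (E0 : J0_sum 0 = 1) by (rewrite <- (J0_sum_from_harmonic_sums 0); ring).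
  fold (J0_sum 0) in HL. rewrite E0 in HL.
  (* |J0_sum t - 1| <= K |t| <= 1/2 for t = r. *)
  set (r := Rmin (d / 2) (/ (2 * K))).
  assert (Hr : (0 < r)%R)
    by (apply Rmin_glb_lt; [lra|apply Rinv_0_lt_compat; lra]).
  exists (RtoC (ln r)). unfold uJ. rewrite Cexp_RtoC, exp_ln by exact Hr.
  intros Hz.
  assert (Hrd : (Cmod (RtoC r) < d)%R).
  { rewrite Cmod_R, Rabs_pos_eq by lra. pose proof (Rmin_l (d / 2) (/ (2 * K))).
    fold r in H0. lra. }
  specialize (HL (RtoC r) Hrd). rewrite Cplus_0_l in HL. fold (J0_sum (RtoC r)) in HL.
  rewrite Hz in HL. replace (0 - 1) with (RtoC (0 - 1)) in HL by (rewrite RtoC_minus; ring).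
  rewrite !Cmod_R, (Rabs_pos_eq r), Rminus_0_l, Rabs_Ropp, Rabs_R1 in HL by lra.
  assert (K * r <= K * / (2 * K))%R by (apply Rmult_le_compat_l; [lra|apply Rmin_r]).
  replace (K * / (2 * K))%R with (1 / 2)%R in H0 by (field; lra). lra.
Qed.

(** * Differentiable functions on C^3 *)

Definition C3_NormedModule : NormedModule C_AbsRing :=
  prod_NormedModule C_AbsRing
    (prod_NormedModule C_AbsRing C_NormedModule C_NormedModule) C_NormedModule.

Definition norm3 (h : C3) : R := @norm C_AbsRing C3_NormedModule h.

Definition add3 (p h : C3) : C3 :=
  (fst (fst p) + fst (fst h), snd (fst p) + snd (fst h), snd p + snd h).

Definition linear3 (a b c : C) (h : C3) : C :=
  a * fst (fst h) + b * snd (fst h) + c * snd h.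

Definition has_grad (f : C3 -> C) (p : C3) (a b c : C) : Prop :=
  expands norm3 (fun h => f (add3 p h)) (f p) (linear3 a b c).

Lemma norm3_ge_0 (h : C3) : (0 <= norm3 h)%R.
Proof. exact (@norm_ge_0 C_AbsRing C3_NormedModule h). Qed.

Lemma norm3_lower (h : C3) :
  (Cmod (fst (fst h)) <= norm3 h)%R /\ (Cmod (snd (fst h)) <= norm3 h)%R /\
  (Cmod (snd h) <= norm3 h)%R.
Proof.
  destruct h as [[x y] z]. unfold norm3; simpl fst; simpl snd.
  destruct (@norm_prod C_AbsRing (prod_NormedModule C_AbsRing C_NormedModule C_NormedModule)
              C_NormedModule (x, y) z) as [H _].
  destruct (@norm_prod C_AbsRing C_NormedModule C_NormedModule x y) as [H' _].
  change (@norm C_AbsRing C_NormedModule x) with (Cmod x) in *.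
  change (@norm C_AbsRing C_NormedModule y) with (Cmod y) in *.
  change (@norm C_AbsRing C_NormedModule z) with (Cmod z) in *.
  assert (Hxy : (Rmax (Cmod x) (Cmod y) <= norm3 (x, y, z))%R).
  { eapply Rle_trans; [exact H'|]. eapply Rle_trans; [|exact H]. apply Rmax_l. }
  repeat split.
  - eapply Rle_trans; [apply Rmax_l|exact Hxy].
  - eapply Rle_trans; [apply Rmax_r|exact Hxy].
  - eapply Rle_trans; [|exact H]. apply Rmax_r.
Qed.

Lemma norm3_upper (h : C3) :
  (norm3 h <= 4 * (Cmod (fst (fst h)) + Cmod (snd (fst h)) + Cmod (snd h)))%R.
Proof.
  destruct h as [[x y] z]. unfold norm3; simpl fst; simpl snd.
  destruct (@norm_prod C_AbsRing (prod_NormedModule C_AbsRing C_NormedModule C_NormedModule)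
              C_NormedModule (x, y) z) as [_ H].
  destruct (@norm_prod C_AbsRing C_NormedModule C_NormedModule x y) as [_ H'].
  change (@norm C_AbsRing C_NormedModule x) with (Cmod x) in *.
  change (@norm C_AbsRing C_NormedModule y) with (Cmod y) in *.
  change (@norm C_AbsRing C_NormedModule z) with (Cmod z) in *.
  pose proof (Cmod_ge_0 x). pose proof (Cmod_ge_0 y). pose proof (Cmod_ge_0 z).
  assert (Hs : (0 <= sqrt 2 <= 2)%R).
  { split; [apply sqrt_pos|]. rewrite <- (sqrt_square 2) at 2 by lra.
    apply sqrt_le_1; lra. }
  assert (Hxy : (norm ((x, y) : prod_NormedModule C_AbsRing C_NormedModule C_NormedModule)
                <= 2 * (Cmod x + Cmod y))%R).
  { eapply Rle_trans; [exact H'|]. apply Rmult_le_compat; try lra.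
    - eapply Rle_trans; [|apply Rmax_l]; lra.
    - apply Rmax_lub; lra. }
  eapply Rle_trans; [exact H|].
  replace (4 * (Cmod x + Cmod y + Cmod z))%R
    with (2 * (2 * (Cmod x + Cmod y + Cmod z)))%R by ring.
  apply Rmult_le_compat; try lra.
  - eapply Rle_trans; [|apply Rmax_r]; lra.
  - apply Rmax_lub; lra.
Qed.

Lemma triple_eq (x y z x' y' z' : C) :
  x = x' -> y = y' -> z = z' -> (x, y, z) = (x', y', z') :> C3.
Proof. intros -> -> ->; reflexivity. Qed.

Lemma add3_minus (p q : C3) : add3 p (@minus C3_NormedModule q p) = q.
Proof.
  destruct p as [[x y] z], q as [[x' y'] z'].
  change ((x + (x' + - x), y + (y' + - y), z + (z' + - z)) = (x', y', z')).
  apply triple_eq; ring.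
Qed.

Lemma minus_add3 (p h : C3) : @minus C3_NormedModule (add3 p h) p = h.
Proof.
  destruct p as [[x y] z], h as [[x' y'] z'].
  change ((x + x' + - x, y + y' + - y, z + z' + - z) = (x', y', z')).
  apply triple_eq; ring.
Qed.

Lemma locally_norm3 (p : C3) (P : C3 -> Prop) :
  @locally C3_NormedModule p P ->
  exists r : R, (0 < r)%R /\ forall h, (norm3 h < r)%R -> P (add3 p h).
Proof.
  intros [e He]. exists e; split; [apply cond_pos|].
  intros h Hh. apply He. apply (@norm_compat1 C_AbsRing C3_NormedModule).
  rewrite minus_add3. exact Hh.
Qed.

Lemma linear3_bound (a b c : C) (h : C3) :
  (Cmod (linear3 a b c h) <= (Cmod a + Cmod b + Cmod c) * norm3 h)%R.
Proof.
  destruct (norm3_lower h) as [N1 [N2 N3]]. unfold linear3.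
  eapply Rle_trans; [apply Cmod_triangle|].
  eapply Rle_trans; [apply Rplus_le_compat_r, Cmod_triangle|]. rewrite !Cmod_mult.
  pose proof (Rmult_le_compat_l _ _ _ (Cmod_ge_0 a) N1).
  pose proof (Rmult_le_compat_l _ _ _ (Cmod_ge_0 b) N2).
  pose proof (Rmult_le_compat_l _ _ _ (Cmod_ge_0 c) N3). lra.
Qed.

Lemma is_linear_linear3 (a b c : C) :
  @is_linear C_AbsRing C3_NormedModule C_NormedModule (linear3 a b c).
Proof.
  split.
  - intros [[x y] z] [[x' y'] z'].
    change (a * (x + x') + b * (y + y') + c * (z + z')
            = a * x + b * y + c * z + (a * x' + b * y' + c * z')). ring.
  - intros k [[x y] z].
    change (a * (k * x) + b * (k * y) + c * (k * z) = k * (a * x + b * y + c * z)). ring.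
  - exists (Cmod a + Cmod b + Cmod c + 1)%R.
    pose proof (Cmod_ge_0 a). pose proof (Cmod_ge_0 b). pose proof (Cmod_ge_0 c).
    split; [lra|]. intros h.
    apply Rle_trans with ((Cmod a + Cmod b + Cmod c) * norm3 h)%R.
    + exact (linear3_bound a b c h).
    + apply Rmult_le_compat_r; [apply norm3_ge_0|lra].
Qed.

Lemma has_grad_ex_filterdiff (f : C3 -> C) (p : C3) (a b c : C) :
  has_grad f p a b c ->
  @ex_filterdiff C_AbsRing C3_NormedModule C_NormedModule f (@locally C3_NormedModule p).
Proof.
  intros [_ H]. exists (linear3 a b c). split; [apply is_linear_linear3|].
  intros q Hq. apply is_filter_lim_locally_unique in Hq. subst q.
  intros eps. destruct (H eps (cond_pos eps)) as [d [Hd Hd']].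
  apply (filter_imp (fun q =>
    (@norm C_AbsRing C3_NormedModule (@minus C3_NormedModule q p) < d)%R)).
  - intros q Hq. specialize (Hd' _ Hq). rewrite add3_minus in Hd'. exact Hd'.
  - pose proof (@norm_factor_gt_0 C_AbsRing C3_NormedModule) as Hf.
    assert (Hdf : (0 < d / @norm_factor C_AbsRing C3_NormedModule)%R)
      by (apply Rdiv_lt_0_compat; assumption).
    exists (mkposreal _ Hdf). intros q Hq.
    pose proof (@norm_compat2 C_AbsRing C3_NormedModule p q _ Hq) as Hn. simpl in Hn.
    replace d with (@norm_factor C_AbsRing C3_NormedModule *
                    (d / @norm_factor C_AbsRing C3_NormedModule))%R by (field; lra).
    exact Hn.
Qed.

Lemma ex_filterdiff_has_grad (f : C3 -> C) (p : C3) :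
  @ex_filterdiff C_AbsRing C3_NormedModule C_NormedModule f (@locally C3_NormedModule p) ->
  exists a b c, has_grad f p a b c.
Proof.
  intros [L [HL H]].
  exists (L (RtoC 1, RtoC 0, RtoC 0)), (L (RtoC 0, RtoC 1, RtoC 0)), (L (RtoC 0, RtoC 0, RtoC 1)).
  assert (E : forall h : C3, L h = linear3 (L (RtoC 1, RtoC 0, RtoC 0))
              (L (RtoC 0, RtoC 1, RtoC 0)) (L (RtoC 0, RtoC 0, RtoC 1)) h).
  { intros [[x y] z]. unfold linear3; simpl fst; simpl snd.
    destruct HL as [Hp Hs _].
    set (ex := (RtoC 1, RtoC 0, RtoC 0) : C3_NormedModule).
    set (ey := (RtoC 0, RtoC 1, RtoC 0) : C3_NormedModule).
    set (ez := (RtoC 0, RtoC 0, RtoC 1) : C3_NormedModule).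
    transitivity (L (plus (plus (scal x ex) (scal y ey)) (scal z ez))).
    - f_equal.
      change ((x, y, z) = (x * 1 + y * 0 + z * 0, x * 0 + y * 1 + z * 0,
                           x * 0 + y * 0 + z * 1)).
      apply triple_eq; ring.
    - rewrite Hp, Hp, !Hs.
      change (@eq C (x * L ex + y * L ey + z * L ez) (L ex * x + L ey * y + L ez * z)). ring. }
  split.
  - eexists; apply linear3_bound.
  - intros eps Heps.
    pose proof (H p (fun P HP => HP) (mkposreal eps Heps)) as Hl.
    destruct (locally_norm3 p _ Hl) as [r [Hr Hr']].
    exists r; split; [exact Hr|]. intros h Hh. specialize (Hr' h Hh).
    cbv beta in Hr'. rewrite minus_add3 in Hr'. rewrite <- E. exact Hr'.
Qed.

Lemma has_grad_ext (f g : C3 -> C) (p : C3) (a b c a' b' c' : C) :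
  has_grad f p a b c -> (forall q, f q = g q) -> a = a' -> b = b' -> c = c' ->
  has_grad g p a' b' c'.
Proof.
  intros H Hf <- <- <-. eapply expands_ext; [exact H| | |reflexivity].
  - intros h; apply Hf.
  - apply Hf.
Qed.

Lemma C_derive_real (f : C -> C) (z l : C) :
  expands Rabs (fun h => f (z + RtoC h)) (f z) (fun h => l * RtoC h) -> C_derive f z = l.
Proof.
  intros H. apply C_lim_real. intros eps Heps.
  assert (Hn : expands Rabs (fun h => f (z + RtoC h) - f z) 0 (fun h => l * RtoC h)).
  { eapply expands_ext.
    - apply expands_minus; [apply Rabs_pos|exact H|apply (expands_const Rabs Rabs_pos (f z))].
    - reflexivity.
    - ring.
    - intros h; simpl; ring. }
  assert (Hd : expands Rabs (fun h => RtoC h) 0 (fun h => 1 * RtoC h)).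
  { apply expands_ext with (f := fun h => RtoC h) (a := RtoC 0) (L := fun h => RtoC h);
      [|reflexivity|reflexivity|intros h; ring].
    apply (expands_linear Rabs Rabs_pos _ 1). intros h; rewrite Cmod_R; lra. }
  destruct (expands_quotient_lim _ _ l 1 C1_nz Hn Hd eps Heps) as [d [Hd0 Hd1]].
  exists d; split; [exact Hd0|]. intros h Hh Hhd. specialize (Hd1 h Hh Hhd).
  replace (z + RtoC h - z) with (RtoC h) by ring.
  replace (l / 1) with l in Hd1 by field. exact Hd1.
Qed.

Lemma has_grad_along (f : C3 -> C) (p e : C3) (a b c : C) :
  has_grad f p a b c ->
  expands Rabs (fun h => f (add3 p (RtoC h * fst (fst e), RtoC h * snd (fst e), RtoC h * snd e)))
    (f p) (fun h => linear3 a b c e * RtoC h).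
Proof.
  intros H.
  pose proof (Cmod_ge_0 (fst (fst e))). pose proof (Cmod_ge_0 (snd (fst e))).
  pose proof (Cmod_ge_0 (snd e)).
  eapply expands_ext.
  - apply (expands_precomp norm3 Rabs
      (fun h => (RtoC h * fst (fst e), RtoC h * snd (fst e), RtoC h * snd e))
      (4 * (Cmod (fst (fst e)) + Cmod (snd (fst e)) + Cmod (snd e)) + 1)) with (3 := H);
      [lra|].
    intros h; split; [apply norm3_ge_0|].
    eapply Rle_trans; [apply norm3_upper|]. simpl fst; simpl snd.
    rewrite !Cmod_mult, Cmod_R. pose proof (Rabs_pos h). nra.
  - reflexivity.
  - reflexivity.
  - intros h. unfold linear3; simpl. ring.
Qed.

Lemma has_grad_partials (f : C3 -> C) (p : C3) (a b c : C) :
  has_grad f p a b c -> Defs.Dx f p = a /\ Dy f p = b /\ Dz f p = c.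
Proof.
  destruct p as [[x y] z]. intros H. unfold Defs.Dx, Dy, Dz.
  repeat split; apply C_derive_real.
  - eapply expands_ext; [apply (has_grad_along f (x, y, z) (RtoC 1, RtoC 0, RtoC 0)), H| | |].
    + intros h. unfold add3; simpl. f_equal. apply triple_eq; ring.
    + reflexivity.
    + intros h. unfold linear3; simpl. ring.
  - eapply expands_ext; [apply (has_grad_along f (x, y, z) (RtoC 0, RtoC 1, RtoC 0)), H| | |].
    + intros h. unfold add3; simpl. f_equal. apply triple_eq; ring.
    + reflexivity.
    + intros h. unfold linear3; simpl. ring.
  - eapply expands_ext; [apply (has_grad_along f (x, y, z) (RtoC 0, RtoC 0, RtoC 1)), H| | |].
    + intros h. unfold add3; simpl. f_equal. apply triple_eq; ring.
    + reflexivity.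
    + intros h. unfold linear3; simpl. ring.
Qed.

Lemma has_grad_coord1 (p : C3) : has_grad (fun q => fst (fst q)) p 1 0 0.
Proof.
  eapply expands_ext.
  - apply expands_plus; [apply (expands_const norm3 norm3_ge_0 (fst (fst p)))|].
    apply (expands_linear norm3 norm3_ge_0 (fun h => fst (fst h)) 1).
    intros h; destruct (norm3_lower h); lra.
  - reflexivity.
  - ring.
  - intros h; unfold linear3; simpl; ring.
Qed.

Lemma has_grad_coord2 (p : C3) : has_grad (fun q => snd (fst q)) p 0 1 0.
Proof.
  eapply expands_ext.
  - apply expands_plus; [apply (expands_const norm3 norm3_ge_0 (snd (fst p)))|].
    apply (expands_linear norm3 norm3_ge_0 (fun h => snd (fst h)) 1).
    intros h; destruct (norm3_lower h) as [? [? ?]]; lra.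
  - reflexivity.
  - ring.
  - intros h; unfold linear3; simpl; ring.
Qed.

Lemma has_grad_of_coord3 (g : C -> C) (p : C3) (l : C) :
  has_deriv g (snd p) l -> has_grad (fun q => g (snd q)) p 0 0 l.
Proof.
  intros H. eapply expands_ext.
  - apply (expands_precomp Cmod norm3 (fun h : C3 => snd h) 1) with (3 := H); [lra|].
    intros h; destruct (norm3_lower h) as [? [? ?]]. pose proof (Cmod_ge_0 (snd h)). lra.
  - reflexivity.
  - reflexivity.
  - intros h; unfold linear3; simpl; ring.
Qed.

Lemma has_grad_plus (f g : C3 -> C) (p : C3) (a b c a' b' c' : C) :
  has_grad f p a b c -> has_grad g p a' b' c' ->
  has_grad (fun q => f q + g q) p (a + a') (b + b') (c + c').
Proof.
  intros Hf Hg. eapply expands_ext; [apply (expands_plus _ _ _ _ _ _ _ Hf Hg)|reflexivity..|].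
  intros h; unfold linear3; simpl; ring.
Qed.

Lemma has_grad_mult (f g : C3 -> C) (p : C3) (a b c a' b' c' : C) :
  has_grad f p a b c -> has_grad g p a' b' c' ->
  has_grad (fun q => f q * g q) p
    (a * g p + f p * a') (b * g p + f p * b') (c * g p + f p * c').
Proof.
  intros Hf Hg. eapply expands_ext;
    [apply (expands_mult _ norm3_ge_0 _ _ _ _ _ _ Hf Hg)|reflexivity..|].
  intros h; unfold linear3; simpl; ring.
Qed.

Lemma has_grad_scal (k : C) (f : C3 -> C) (p : C3) (a b c : C) :
  has_grad f p a b c -> has_grad (fun q => k * f q) p (k * a) (k * b) (k * c).
Proof.
  intros Hf. eapply expands_ext;
    [apply (expands_scal _ norm3_ge_0 k _ _ _ Hf)|reflexivity..|].
  intros h; unfold linear3; simpl; ring.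
Qed.

Lemma has_grad_div (f g : C3 -> C) (p : C3) (a b c a' b' c' : C) :
  g p <> 0 -> has_grad f p a b c -> has_grad g p a' b' c' ->
  has_grad (fun q => f q / g q) p
    ((a * g p - f p * a') / (g p * g p)) ((b * g p - f p * b') / (g p * g p))
    ((c * g p - f p * c') / (g p * g p)).
Proof.
  intros H0 Hf Hg. eapply expands_ext;
    [apply (expands_div norm3 _ _ _ _ _ _ norm3_ge_0 H0 Hf Hg)|reflexivity..|].
  intros h; unfold linear3; simpl; field; exact H0.
Qed.

Lemma has_grad_near (f g : C3 -> C) (p : C3) (a b c : C) :
  @locally C3_NormedModule p (fun q => f q = g q) ->
  has_grad f p a b c -> has_grad g p a b c.
Proof.
  intros Hl H. destruct (locally_norm3 _ _ Hl) as [r [Hr Hr']].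
  unfold has_grad. rewrite <- (locally_singleton _ _ Hl).
  apply expands_ext_near with (2 := Hr') (3 := H). exact Hr.
Qed.

(** * The Hill foliation and its first integral *)

(** With v = - u' this is the Wronskian y u - x u' of u and of the solution with
    value x and derivative y at z. *)
Definition hill_wronskian (u v : C -> C) (p : C3) : C :=
  snd (fst p) * u (snd p) + fst (fst p) * v (snd p).

Lemma has_grad_hill_wronskian (u v : C -> C) (p : C3) :
  has_deriv u (snd p) (- v (snd p)) -> has_deriv v (snd p) (Cexp (snd p) * u (snd p)) ->
  has_grad (hill_wronskian u v) p (v (snd p)) (u (snd p))
    (- snd (fst p) * v (snd p) + fst (fst p) * (Cexp (snd p) * u (snd p))).
Proof.
  intros Hu Hv. eapply has_grad_ext.
  - apply has_grad_plus; apply has_grad_mult;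
      [apply has_grad_coord2|apply has_grad_of_coord3, Hu
      |apply has_grad_coord1|apply has_grad_of_coord3, Hv].
  - reflexivity.
  - simpl; ring.
  - simpl; ring.
  - simpl; ring.
Qed.

Lemma H_num_eq (p : C3) : H_num p = 2 * hill_wronskian uY vY p.
Proof.
  destruct p as [[x y] z]; unfold H_num, hill_wronskian; simpl fst; simpl snd.
  rewrite besselY_0, <- besselY_1. ring.
Qed.

Lemma H_den_eq (p : C3) : H_den p = hill_wronskian uJ vJ p.
Proof.
  destruct p as [[x y] z]; unfold H_den, hill_wronskian; simpl fst; simpl snd.
  unfold vJ, uJ. rewrite besselJ_0, <- besselJ_1. ring.
Qed.

Lemma has_grad_H_num (p : C3) :
  has_grad H_num p (2 * vY (snd p)) (2 * uY (snd p))
    (2 * (- snd (fst p) * vY (snd p) + fst (fst p) * (Cexp (snd p) * uY (snd p)))).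
Proof.
  eapply has_grad_ext; [apply (has_grad_scal 2), (has_grad_hill_wronskian uY vY p)| | | |];
    try reflexivity.
  - apply has_deriv_uY.
  - apply has_deriv_vY.
  - intros q; symmetry; apply H_num_eq.
Qed.

Lemma has_grad_H_den (p : C3) :
  has_grad H_den p (vJ (snd p)) (uJ (snd p))
    (- snd (fst p) * vJ (snd p) + fst (fst p) * (Cexp (snd p) * uJ (snd p))).
Proof.
  eapply has_grad_ext; [apply (has_grad_hill_wronskian uJ vJ p)| | | |]; try reflexivity.
  - apply has_deriv_uJ.
  - apply has_deriv_vJ.
  - intros q; symmetry; apply H_den_eq.
Qed.

Lemma has_grad_hill_dx (p : C3) : has_grad (c_dx (hill_form Cexp)) p 0 (-(1)) 0.
Proof.
  eapply has_grad_ext; [apply (has_grad_scal (-(1))), has_grad_coord2| | | |]; try ring.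
  intros [[x y] z]; simpl; ring.
Qed.

Lemma has_grad_hill_dy (p : C3) : has_grad (c_dy (hill_form Cexp)) p 1 0 0.
Proof.
  eapply has_grad_ext; [apply has_grad_coord1| | | |]; try ring.
  intros [[x y] z]; reflexivity.
Qed.

Lemma has_grad_hill_dz (p : C3) :
  has_grad (c_dz (hill_form Cexp)) p
    (2 * Cexp (snd p) * fst (fst p)) (2 * snd (fst p))
    (Cexp (snd p) * (fst (fst p) * fst (fst p))).
Proof.
  eapply has_grad_ext.
  - apply has_grad_plus; [apply has_grad_mult; apply has_grad_coord2|].
    apply has_grad_mult; [apply has_grad_of_coord3, expands_Cexp|].
    apply has_grad_mult; apply has_grad_coord1.
  - intros [[x y] z]; reflexivity.
  - simpl; ring.
  - simpl; ring.
  - simpl; ring.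
Qed.

(** Partial derivatives determine the gradient, so functions that agree near
    [p] have the same one. *)
Lemma has_grad_unique (f g : C3 -> C) (p : C3) (a b c a' b' c' : C) :
  @locally C3_NormedModule p (fun q => f q = g q) ->
  has_grad f p a b c -> has_grad g p a' b' c' -> a = a' /\ b = b' /\ c = c'.
Proof.
  intros Hl Hf Hg. apply (has_grad_near _ _ _ _ _ _ Hl) in Hf.
  destruct (has_grad_partials _ _ _ _ _ Hf) as [<- [<- <-]].
  destruct (has_grad_partials _ _ _ _ _ Hg) as [<- [<- <-]]. auto.
Qed.

(** Suppose g(p) = 0 with -y = g a and x = g b near p.  Differentiating the two
    equations at p gives 1 = g_x b, 0 = g_y b and -1 = g_y a: the first says that
    b(p) is not 0, hence g_y = 0, against the third. *)
Lemma hill_form_reduced : reduced (hill_form Cexp).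
Proof.
  intros p g a b c Hg Ha Hb _ Hl Hgp.
  apply locally_singleton, ex_filterdiff_has_grad in Hg as [g1 [g2 [g3 Hg]]].
  apply locally_singleton, ex_filterdiff_has_grad in Ha as [a1 [a2 [a3 Ha]]].
  apply locally_singleton, ex_filterdiff_has_grad in Hb as [b1 [b2 [b3 Hb]]].
  destruct (has_grad_unique (c_dx (hill_form Cexp)) (fun q => g q * a q) p
              _ _ _ _ _ _ ltac:(eapply filter_imp; [|exact Hl]; intros q Hq; apply Hq)
              (has_grad_hill_dx p) (has_grad_mult _ _ _ _ _ _ _ _ _ Hg Ha))
    as [_ [E1 _]].
  destruct (has_grad_unique (c_dy (hill_form Cexp)) (fun q => g q * b q) p
              _ _ _ _ _ _ ltac:(eapply filter_imp; [|exact Hl]; intros q Hq; apply Hq)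
              (has_grad_hill_dy p) (has_grad_mult _ _ _ _ _ _ _ _ _ Hg Hb))
    as [E2 [E3 _]].
  rewrite Hgp, Cmult_0_l, Cplus_0_r in E1, E2, E3.
  apply C1_nz.
  replace (RtoC 1) with ((g1 * b p) * - (- (1))) by (rewrite <- E2; ring).
  rewrite E1.
  replace (g1 * b p * - (g2 * a p)) with (- g1 * a p * (g2 * b p)) by ring.
  rewrite <- E3; ring.
Qed.

Lemma hill_form_foliation : foliation (hill_form Cexp).
Proof.
  repeat split.
  - intros p; exact (has_grad_ex_filterdiff _ _ _ _ _ (has_grad_hill_dx p)).
  - intros p; exact (has_grad_ex_filterdiff _ _ _ _ _ (has_grad_hill_dy p)).
  - intros p; exact (has_grad_ex_filterdiff _ _ _ _ _ (has_grad_hill_dz p)).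
  - exists (RtoC 1, RtoC 0, RtoC 0). intros [_ [H _]]. exact (C1_nz H).
  - apply hill_form_reduced.
  - intros p.
    destruct (has_grad_partials _ _ _ _ _ (has_grad_hill_dx p)) as [_ [X2 X3]].
    destruct (has_grad_partials _ _ _ _ _ (has_grad_hill_dy p)) as [Y1 [_ Y3]].
    destruct (has_grad_partials _ _ _ _ _ (has_grad_hill_dz p)) as [Z1 [Z2 _]].
    unfold wedge12, ext_derivative; cbn [c_dydz c_dzdx c_dxdy].
    rewrite X2, X3, Y1, Y3, Z1, Z2. destruct p as [[x y] z]; simpl. ring.
Qed.

Lemma hill_form_tangent : tangent (hill_field Cexp) (hill_form Cexp).
Proof. intros [[x y] z]; unfold contract; simpl. ring. Qed.

(** Writing P and Q for numerator and denominator, dP and dQ are such that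
    Q dP - P dQ is a function multiple of the Hill form; this is an identity in
    x, y and the values of the four functions uJ, vJ, uY, vY at z. *)
Lemma hill_first_integral : first_integral (hill_form Cexp) H_num H_den.
Proof.
  split; [|split; [|split]].
  - intros p; exact (has_grad_ex_filterdiff _ _ _ _ _ (has_grad_H_num p)).
  - intros p; exact (has_grad_ex_filterdiff _ _ _ _ _ (has_grad_H_den p)).
  - destruct uJ_not_zero as [z Hz].
    assert (EQ : forall w, H_den (RtoC 0, RtoC 1, w) = uJ w)
      by (intros w; rewrite H_den_eq; unfold hill_wronskian; simpl; ring).
    assert (EP : forall w, H_num (RtoC 0, RtoC 1, w) = 2 * uY w)
      by (intros w; rewrite H_num_eq; unfold hill_wronskian; simpl; ring).
    exists (RtoC 0, RtoC 1, z), (RtoC 0, RtoC 1, z + 2 * PI * Ci).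
    rewrite !EQ, !EP, uJ_period, uY_monodromy.
    repeat split; try assumption. intros E.
    apply (Cmult_neq_0 (2 * 2) Ci).
    + apply Cmult_neq_0; intros E2; apply RtoC_inj in E2; lra.
    + apply Ci_nz.
    + replace (2 * 2 * Ci) with (2 * (uY z + 2 * Ci * uJ z) / uJ z - 2 * uY z / uJ z)
        by (field; exact Hz).
      rewrite E; ring.
  - intros p Hp.
    destruct (has_grad_partials _ _ _ _ _
                (has_grad_div _ _ _ _ _ _ _ _ _ Hp (has_grad_H_num p) (has_grad_H_den p)))
      as [E1 [E2 E3]].
    unfold two_form_vanishes_at, wedge11, Defs.differential;
      cbn [c_dydz c_dzdx c_dxdy c_dx c_dy c_dz].
    rewrite E1, E2, E3. clear E1 E2 E3.
    rewrite H_den_eq in *. rewrite H_num_eq.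
    destruct p as [[x y] z]; unfold hill_form, hill_wronskian in *;
      simpl fst in *; simpl snd in *; cbn [c_dx c_dy c_dz].
    repeat split; field; exact Hp.
Qed.

Theorem corollary4p10 :
  hill_equation_s_integrable Cexp /\
  (foliation (hill_form Cexp) /\
   tangent (hill_field Cexp) (hill_form Cexp) /\
   first_integral (hill_form Cexp) H_num H_den).
Proof.
  pose proof hill_form_foliation as H1. pose proof hill_form_tangent as H2.
  pose proof hill_first_integral as H3.
  split; [|auto].
  exists (hill_form Cexp). repeat split; try apply H1; auto.
  exists H_num, H_den; exact H3.
Qed.
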